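(* Let $\sigma>0$, and let $\boldsymbol W$ be a random symmetric $D\times D$ matrix whose upper triangular entries (including the diagonal) are i.i.d. $N(0,\sigma^2)$, with $\boldsymbol S=\boldsymbol\Theta\boldsymbol\Theta^T+\boldsymbol W$ as in the context. Let $d=D/m$. If $\sigma\le\frac{m^{1/4}}{31\sqrt{rd}}$ and either $m\ge3$, or $m\ge2$ and $\min_{1\le i\le m}d_i\ge6$, then with probability at least $1-\frac1m-2\exp\left(-\frac{(3-2\sqrt2)^2}{4}D\right)$, all candidate critical points $\boldsymbol O=(\boldsymbol O_1,\dots,\boldsymbol O_m)$ of (OTSM) satisfying $\mathrm{tr}(\boldsymbol\Theta^T\boldsymbol S\boldsymbol\Theta)\le\mathrm{tr}(\boldsymbol O^T\boldsymbol S\boldsymbol O)$ are global optima of (OTSM).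
   Context: Let $m,r\ge1$ and $d_1,\dots,d_m$ be integers with $r\le\min_i d_i$, and $D=\sum_{i=1}^m d_i$. $\mathcal O_{d,r}=\{\boldsymbol O\in\mathbb R^{d\times r}:\boldsymbol O^T\boldsymbol O=\mathbf I_r\}$. A $D\times D$ matrix $\boldsymbol X$ is partitioned into blocks $\boldsymbol X_{ij}\in\mathbb R^{d_i\times d_j}$, and a $D\times r$ matrix $\boldsymbol Y$ into blocks $\boldsymbol Y_i\in\mathbb R^{d_i\times r}$. A tuple $(\boldsymbol O_1,\dots,\boldsymbol O_m)$ is identified with the stacked matrix $\boldsymbol O\in\mathbb R^{D\times r}$. MAXBET model: $\boldsymbol\Theta_i\in\mathcal O_{d_i,r}$ for $i=1,\dots,m$ are fixed, $\boldsymbol\Theta\in\mathbb R^{D\times r}$ is the matrix with blocks $\boldsymbol\Theta_i$, $\boldsymbol W\in\mathbb R^{D\times D}$ is symmetric, and $\boldsymbol S_{ij}=\boldsymbol\Theta_i\boldsymbol\Theta_j^T+\boldsymbol W_{ij}$ for all $1\le i,j\le m$, i.e. $\boldsymbol S=\boldsymbol\Theta\boldsymbol\Theta^T+\boldsymbol W$. (OTSM): maximize $\sum_{i,j=1}^m\mathrm{tr}(\boldsymbol O_i^T\boldsymbol S_{ij}\boldsymbol O_j)=\mathrm{tr}(\boldsymbol O^T\boldsymbol S\boldsymbol O)$ subject to $\boldsymbol O_i\in\mathcal O_{d_i,r}$, $i=1,\dots,m$. A point $\boldsymbol O\in\prod_i\mathcal O_{d_i,r}$ is a critical point if for every $i$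 there is a symmetric $\boldsymbol\Lambda_i\in\mathbb R^{r\times r}$ with $\boldsymbol O_i\boldsymbol\Lambda_i=\sum_{j=1}^m\boldsymbol S_{ij}\boldsymbol O_j$ (so that $\boldsymbol\Lambda_i=\boldsymbol O_i^T\sum_{j=1}^m\boldsymbol S_{ij}\boldsymbol O_j$). It is a candidate critical point if in addition every $\boldsymbol\Lambda_i$ is positive semidefinite. *)

(* Defs.v *)
From HB Require Import structures.
From mathcomp Require Import all_boot all_order all_algebra.
From mathcomp Require Import all_classical all_reals all_analysis.

Set Implicit Arguments.
Unset Strict Implicit.
Unset Printing Implicit Defensive.

Import Order.TTheory GRing.Theory Num.Theory.
Import numFieldNormedType.Exports.

Local Open Scope classical_set_scope.
Local Open Scope ring_scope.

Notation total_dim d := (\sum_i d i)%N (only parsing).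

Section OTSM.
Context {R : realType} {m : nat} {d : 'I_m -> nat} {r : nat}.

Definition stiefel n (O : 'M[R]_(n, r)) : Prop := O^T *m O = 1%:M.

Definition psdmx n (A : 'M[R]_n) : Prop :=
  A^T = A /\ forall x : 'cV[R]_n, 0 <= (x^T *m A *m x) 0 0.

Implicit Types (S : 'M[R]_(total_dim d)) (O : forall i, 'M[R]_(d i, r)).

Definition otsm_feasible O : Prop := forall i, stiefel (O i).

Definition otsm_objective S O : R :=
  \sum_i \sum_j \tr ((O i)^T *m submxblock S i j *m O j).

Lemma otsm_objectiveE S O :
  otsm_objective S O = \tr ((\mxcol_i O i)^T *m S *m \mxcol_i O i).
Proof.
rewrite -mulmxA -[S in RHS]submxblockK mul_mxblock_mxrow tr_mxcol.
rewrite mul_mxrow_mxcol raddf_sum; apply: eq_bigr => i _ /=.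
rewrite mulmx_sumr raddf_sum; apply: eq_bigr => j _ /=.
by rewrite mulmxA.
Qed.

Definition otsm_global_optimum S O : Prop :=
  otsm_feasible O /\
  forall O', otsm_feasible O' -> otsm_objective S O' <= otsm_objective S O.

(* [L] is the (unique, when [O] is feasible) matrix Lambda_i. *)
Definition otsm_multiplier S O (i : 'I_m) (L : 'M[R]_r) : Prop :=
  L^T = L /\ O i *m L = \sum_j submxblock S i j *m O j.

Definition otsm_critical S O : Prop :=
  otsm_feasible O /\ forall i, exists L, otsm_multiplier S O i L.

Definition otsm_candidate_critical S O : Prop :=
  otsm_critical S O /\ forall i L, otsm_multiplier S O i L -> psdmx L.

Definition maxbet_mx (Theta : forall i, 'M[R]_(d i, r))
    (W : 'M[R]_(total_dim d)) : 'M[R]_(total_dim d) :=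
  \mxcol_i Theta i *m (\mxcol_i Theta i)^T + W.

Lemma submxblock_maxbet_mx Theta W i j :
  submxblock (maxbet_mx Theta W) i j =
  Theta i *m (Theta j)^T + submxblock W i j.
Proof.
by rewrite /maxbet_mx submxblockD tr_mxcol mul_mxcol_mxrow mxblockK.
Qed.

End OTSM.

Section Probability.
Context {disp : measure_display} {Omega : measurableType disp} {R : realType}.
Variable P : probability Omega R.

(* "[E] holds with probability at least [c]", without presupposing that [E] is
   measurable: [P] is only meaningful on measurable sets. *)
Definition prob_at_least (c : R) (E : set Omega) : Prop :=
  exists A, [/\ measurable A, A `<=` E & (c%:E <= P A)%E].

Lemma prob_at_leastE c E : measurable E ->
  prob_at_least c E <-> (c%:E <= P E)%E.
Proof.
move=> mE; split=> [[A [mA AE cA]]|cE]; last by exists E; split.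
by apply: (le_trans cA); apply: le_measure; rewrite ?inE.
Qed.

Definition mutually_independent (I : finType) (X : I -> {RV P >-> R}) : Prop :=
  forall (J : {set I}) (A : I -> set R), (forall i, measurable (A i)) ->
    P (\bigcap_(i in [set` J]) (X i @^-1` A i)) =
    (\prod_(i in J) P (X i @^-1` A i))%E.

(* The second parameter of [normal_prob] is the standard deviation. *)
Definition gaussian (mu sigma : R) (X : {RV P >-> R}) : Prop :=
  forall A : set R, measurable A -> distribution P X A = normal_prob mu sigma A.

Definition upper_index n := {ij : 'I_n * 'I_n | (ij.1 <= ij.2)%N}.

Definition symmetric_gaussian n (sigma : R)
    (W : 'I_n -> 'I_n -> {RV P >-> R}) : Prop :=
  [/\ forall i j omega, W i j omega = W j i omega,
      forall i j : 'I_n, (i <= j)%N -> gaussian 0 sigma (W i j)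
    & mutually_independent
        (fun k : upper_index n => W (val k).1 (val k).2)].

End Probability.

Definition random_mx {disp : measure_display} {Omega : measurableType disp}
    {R : realType} {P : probability Omega R} n
    (W : 'I_n -> 'I_n -> {RV P >-> R}) (omega : Omega) : 'M[R]_n :=
  \matrix_(i, j) W i j omega.

(* Main.v *)
Require Import Defs.
From HB Require Import structures.
From mathcomp Require Import all_boot all_order all_algebra ring lra zify.
From mathcomp Require Import all_classical all_reals all_analysis.
From mathcomp Require Import measurable_realfun.

Set Implicit Arguments.
Unset Strict Implicit.
Unset Printing Implicit Defensive.

Import Order.TTheory GRing.Theory Num.Theory.
Import numFieldNormedType.Exports.

Local Open Scope classical_set_scope.
Local Open Scope ring_scope.

(** The statement splits into two estimates on the noise W, each likely, and a
    deterministic fact about any W satisfying both. Below w is a number with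
    |x^T W x| <= w |x|^2 for all x, and all matrix norms are Frobenius norms.

    Deterministic part. Let K = Theta^T O be the correlation of the planted
    point with a candidate critical point O, and let Z = O - Theta K / m be the
    part of O orthogonal to the columns of Theta ([residual]). Since Theta^T
    Theta = O^T O = m I, the signal part of the objective is |K|^2 = m^2 r - m
    |Z|^2, so a point at least as good as Theta must recover m |Z|^2 from the
    noise. The noise can only contribute about 2 w |Z| sqrt (m r), whence |Z| <=
    2 w sqrt (m r) / (m - 2 w) ([residual_le]), and K is close to m times an
    orthogonal matrix.

    The multipliers are then bounded below. Since O_i is an isometry, |Lambda_i
    v| = |(S O v)_i| >= |Theta_i^T (S O v)_i|, and the right-hand side is |K v|
    up to noise. Compressing by Theta_i first is essential: it leaves the r x r
    matrix Theta_i^T (W Theta)_i, with operator norm of order sigma sqrt (m r)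
    whatever d_i is, whereas (W Theta)_i itself may exceed the signal when d_i
    is much larger than the average dimension. A positive semidefinite Lambda_i
    with |Lambda_i v| >= mu |v| satisfies Lambda_i >= mu ([psd_ge_of_norm_ge]).
    Finally the block diagonal matrix T with blocks O_i (Lambda_i - mu) O_i^T +
    mu I is a dual certificate ([certificate_global_optimum]): T - S annihilates
    O and is nonnegative on its orthogonal complement, where the signal is small
    ([signal_orth_le]), and V^T T V has trace at most the sum of the tr Lambda_i
    for every feasible V. These steps are assembled in
    [maxbet_candidate_optimal].

    Probabilistic part. Both noise estimates bound a quadratic form which at
    every fixed vector is a centred Gaussian, so they follow from one uniform
    bound ([quad_bounded_whp]): a Gaussian tail at each point of a finite net,
    and a union bound. The net consists of the integer points in a spherical
    shell, at most exp (9 n / 2) of them in dimension n ([card_shell]). Rounding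
    a maximiser of the form to the net only costs the factor 7/8, because a form
    is stationary at its maximiser and the error is of second order
    ([quad_bounded_of_round]). With w = 5 sigma sqrt D the first estimate fails
    with probability at most twice the exponential of the statement; the second
    one, with bound m / 2, fails for a given block with probability at most 1 /
    m^2. *)

(** * The Frobenius inner product and bounded quadratic forms *)

Section FrobeniusProduct.
Context {R : rcfType}.

Definition mxdot n p (A B : 'M[R]_(n, p)) : R := \tr (A^T *m B).

Definition fro n p (A : 'M[R]_(n, p)) : R := Num.sqrt (mxdot A A).

Lemma mxdotE n p (A B : 'M[R]_(n, p)) :
  mxdot A B = \sum_j \sum_i A i j * B i j.
Proof.
rewrite /mxdot /mxtrace; apply: eq_bigr => j _; rewrite mxE.
by apply: eq_bigr => i _; rewrite mxE.
Qed.

Lemma mxdotC n p (A B : 'M[R]_(n, p)) : mxdot A B = mxdot B A.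
Proof. by rewrite /mxdot -mxtrace_tr trmx_mul trmxK. Qed.

Lemma mxdotDr n p (A B C : 'M[R]_(n, p)) :
  mxdot A (B + C) = mxdot A B + mxdot A C.
Proof. by rewrite /mxdot mulmxDr mxtraceD. Qed.

Lemma mxdotDl n p (A B C : 'M[R]_(n, p)) :
  mxdot (A + B) C = mxdot A C + mxdot B C.
Proof. by rewrite mxdotC mxdotDr !(mxdotC C). Qed.

Lemma mxdotZr n p a (A B : 'M[R]_(n, p)) : mxdot A (a *: B) = a * mxdot A B.
Proof. by rewrite /mxdot -scalemxAr mxtraceZ. Qed.

Lemma mxdotZl n p a (A B : 'M[R]_(n, p)) : mxdot (a *: A) B = a * mxdot A B.
Proof. by rewrite mxdotC mxdotZr mxdotC. Qed.

Lemma mxdotNr n p (A B : 'M[R]_(n, p)) : mxdot A (- B) = - mxdot A B.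
Proof. by rewrite -scaleN1r mxdotZr mulN1r. Qed.

Lemma mxdotNl n p (A B : 'M[R]_(n, p)) : mxdot (- A) B = - mxdot A B.
Proof. by rewrite mxdotC mxdotNr mxdotC. Qed.

Lemma mxdot_mull n p q (M : 'M[R]_(n, p)) (A : 'M[R]_(p, q)) (B : 'M[R]_(n, q))
  :
  mxdot (M *m A) B = mxdot A (M^T *m B).
Proof. by rewrite /mxdot trmx_mul mulmxA. Qed.

Lemma mxdot_mulr n p q (M : 'M[R]_(n, p)) (A : 'M[R]_(p, q)) (B : 'M[R]_(n, q))
  :
  mxdot B (M *m A) = mxdot (M^T *m B) A.
Proof. by rewrite mxdotC mxdot_mull mxdotC. Qed.

Lemma mxdot0 n p (A : 'M[R]_(n, p)) : mxdot A 0 = 0.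
Proof. by rewrite /mxdot mulmx0 mxtrace0. Qed.

Lemma mxdot_ge0 n p (A : 'M[R]_(n, p)) : 0 <= mxdot A A.
Proof.
by rewrite mxdotE; apply: sumr_ge0 => j _; apply: sumr_ge0 => i _; rewrite
  -expr2 sqr_ge0.
Qed.

Lemma mxdot_eq0 n p (A : 'M[R]_(n, p)) : mxdot A A = 0 -> A = 0.
Proof.
rewrite mxdotE => /eqP A0; apply/matrixP => i j; rewrite mxE.
move: A0; rewrite psumr_eq0 => [/allP /(_ j)|k _]; last first.
  by apply: sumr_ge0 => l _; rewrite -expr2 sqr_ge0.
rewrite mem_index_enum => /(_ isT) /=.
rewrite psumr_eq0 => [/allP /(_ i)|k _]; last by rewrite -expr2 sqr_ge0.
by rewrite mem_index_enum => /(_ isT) /=; rewrite -expr2 sqrf_eq0 => /eqP.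
Qed.

Lemma fro_ge0 n p (A : 'M[R]_(n, p)) : 0 <= fro A.
Proof. exact: sqrtr_ge0. Qed.

Lemma sqr_fro n p (A : 'M[R]_(n, p)) : fro A ^+ 2 = mxdot A A.
Proof. by rewrite sqr_sqrtr// mxdot_ge0. Qed.

Lemma mxdot_cols n p (A B : 'M[R]_(n, p)) :
  mxdot A B = \sum_j mxdot (col j A) (col j B).
Proof.
rewrite mxdotE; apply: eq_bigr => j _; rewrite mxdotE big_ord1.
by apply: eq_bigr => i _; rewrite !mxE.
Qed.

Lemma quadE n (M : 'M[R]_n) (x : 'cV[R]_n) :
  (x^T *m M *m x) 0 0 = mxdot x (M *m x).
Proof. by rewrite /mxdot mulmxA /mxtrace big_ord1. Qed.

Lemma sqr_le_of_quad_ge0 (a b c : R) : 0 <= c ->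
  (forall t, 0 <= a + 2 * t * b + t ^+ 2 * c) -> b ^+ 2 <= a * c.
Proof.
rewrite le0r => /predU1P[-> pos|c0 pos].
  have [->|b0] := eqVneq b 0; first by rewrite expr0n mulr0.
  (* the polynomial is affine; this is where it takes the value -1 *)
  have := pos (- (a + 1) / (2 * b)).
  have -> : a + 2 * (- (a + 1) / (2 * b)) * b + (- (a + 1) / (2 * b)) ^+ 2 * 0
     = -1 by field.
  by rewrite lerNr oppr0 ler10.
have := pos (- b / c).
have -> : a + 2 * (- b / c) * b + (- b / c) ^+ 2 * c = (a * c - b ^+ 2) / c.
  by field; rewrite gt_eqF.
by rewrite pmulr_lge0 ?invr_gt0// subr_ge0.
Qed.

(** Cauchy-Schwarz for the semi-inner product of M. With M = 1 it is the usual
    inequality; when the form vanishes at B it says that M B = 0, which is how a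
    maximiser of a form turns out to be an eigenvector. *)
Lemma semidef_cauchy_schwarz n p (M : 'M[R]_n) (A B : 'M[R]_(n, p)) :
  M^T = M -> (forall X : 'M[R]_(n, p), 0 <= mxdot X (M *m X)) ->
  mxdot A (M *m B) ^+ 2 <= mxdot A (M *m A) * mxdot B (M *m B).
Proof.
move=> Msym Mpos; apply: sqr_le_of_quad_ge0 => // t.
have := Mpos (A + t *: B).
rewrite mulmxDr -scalemxAr !mxdotDl !mxdotDr !mxdotZl !mxdotZr.
have -> : mxdot B (M *m A) = mxdot A (M *m B).
  by rewrite mxdot_mulr Msym mxdotC.
by congr (_ <= _); ring.
Qed.

Lemma cauchy_schwarz_fro n p (A B : 'M[R]_(n, p)) :
  `|mxdot A B| <= fro A * fro B.
Proof.
rewrite -ler_sqr ?nnegrE ?mulr_ge0 ?fro_ge0// exprMn !sqr_fro real_normK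
  ?num_real//.
have := @semidef_cauchy_schwarz n p 1%:M A B.
by rewrite trmx1 !mul1mx; apply=> // X; rewrite mul1mx mxdot_ge0.
Qed.

Lemma fro_triangle n p (A B : 'M[R]_(n, p)) : fro (A + B) <= fro A + fro B.
Proof.
rewrite -ler_sqr ?nnegrE ?addr_ge0 ?fro_ge0// sqrrD !sqr_fro.
rewrite mxdotDl !mxdotDr (mxdotC B A).
have := le_trans (ler_norm _) (cauchy_schwarz_fro A B).
by move: (mxdot A B) (fro A * fro B) => x y; rewrite mulr2n; lra.
Qed.

Lemma froZ n p a (A : 'M[R]_(n, p)) : fro (a *: A) = `|a| * fro A.
Proof.
by rewrite /fro mxdotZl mxdotZr mulrA -expr2 sqrtrM ?sqr_ge0// sqrtr_sqr.
Qed.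

Lemma fro_mul_col n p (A : 'M[R]_(n, p)) (x : 'cV[R]_p) :
  fro (A *m x) <= fro A * fro x.
Proof.
rewrite -ler_sqr ?nnegrE ?mulr_ge0 ?fro_ge0// exprMn !sqr_fro.
have rows : mxdot A A = \sum_i mxdot (row i A)^T (row i A)^T.
  rewrite mxdotE exchange_big; apply: eq_bigr => i _; rewrite mxdotE big_ord1.
  by apply: eq_bigr => j _; rewrite !mxE.
rewrite rows mulr_suml {1}mxdotE big_ord1; apply: ler_sum => i _.
have -> : (A *m x) i 0 = mxdot (row i A)^T x.
  by rewrite /mxdot trmxK -row_mul /mxtrace big_ord1 !mxE.
rewrite -expr2 -!sqr_fro -exprMn -[leLHS](real_normK (num_real _)).
by rewrite ler_sqr ?nnegrE ?mulr_ge0 ?fro_ge0// cauchy_schwarz_fro.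
Qed.

Lemma fro_le n p (A : 'M[R]_(n, p)) c : 0 <= c -> (fro A <= c) = (mxdot A A <=
  c ^+ 2).
Proof. by move=> c0; rewrite -sqr_fro ler_sqr ?nnegrE ?fro_ge0. Qed.

(** For symmetric M this says that the operator norm of M is at most w; the
    quadratic form is what the net arguments control. *)
Definition quad_bounded n (w : R) (M : 'M[R]_n) :=
  forall x : 'cV[R]_n, `|mxdot x (M *m x)| <= w * mxdot x x.

Lemma quad_bounded_mx n w (M : 'M[R]_n) p (X : 'M[R]_(n, p)) :
  quad_bounded w M -> `|mxdot X (M *m X)| <= w * mxdot X X.
Proof.
move=> bM; rewrite !mxdot_cols mulr_sumr.
apply: le_trans (ler_norm_sum _ _ _) _; apply: ler_sum => j _.
by rewrite (colE j (M *m X)) -mulmxA -colE; exact: bM.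
Qed.

(** Polarisation: applying the bound to X + t Y and to X - t Y for all t gives a
    nonnegative quadratic polynomial in t, and its discriminant is the claim. *)
Lemma quad_bounded_bilinear n w (M : 'M[R]_n) p (X Y : 'M[R]_(n, p)) :
  0 <= w -> M^T = M -> quad_bounded w M ->
  `|mxdot X (M *m Y)| <= w * (fro X * fro Y).
Proof.
move=> w0 Msym bM.
rewrite -ler_sqr ?nnegrE ?mulr_ge0 ?fro_ge0// !exprMn !sqr_fro.
rewrite real_normK ?num_real//.
have -> : w ^+ 2 * (mxdot X X * mxdot Y Y) = (w * mxdot X X) * (w * mxdot Y Y).
  by ring.
apply: sqr_le_of_quad_ge0 => [|t]; first by rewrite mulr_ge0 ?mxdot_ge0.
have := quad_bounded_mx (X + t *: Y) bM.
have := quad_bounded_mx (X - t *: Y) bM.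
rewrite !ler_norml => /andP[_ +] /andP[+ _].
rewrite mulmxBr mulmxDr -!scalemxAr !mxdotDl !mxdotDr !mxdotNr !mxdotNl
  !mxdotZl !mxdotZr.
have -> : mxdot Y (M *m X) = mxdot X (M *m Y).
  by rewrite mxdot_mulr Msym mxdotC.
rewrite (mxdotC Y X); move: (mxdot X X) (mxdot X Y) (mxdot Y Y) (mxdot X (M *m
  X)).
move: (mxdot X (M *m Y)) (mxdot Y (M *m Y)) => b c' xx xy yy a'.
by nra.
Qed.

Lemma quad_bounded_mul n w (M : 'M[R]_n) p (X : 'M[R]_(n, p)) :
  0 <= w -> M^T = M -> quad_bounded w M -> fro (M *m X) <= w * fro X.
Proof.
move=> w0 Msym bM; have [->|N0] := eqVneq (fro (M *m X)) 0.
  by rewrite mulr_ge0// fro_ge0.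
have {}N0 : 0 < fro (M *m X) by rewrite lt0r N0 fro_ge0.
rewrite -(ler_pM2l N0) -expr2 sqr_fro.
have := quad_bounded_bilinear (M *m X) X w0 Msym bM.
by move=> /(le_trans (ler_norm _)) /le_trans; apply; rewrite mulrCA.
Qed.

(** The square root is operator monotone: L^2 >= mu^2 implies L >= mu. Write v =
    L u and a_k = v^T L^k v, so that a_(-2) = |u|^2 and a_(-1) = u^T L u. The
    sequence a is log-convex by Cauchy-Schwarz, so a_0 / a_(-2) <= (a_1 /
    a_0)^2, while the hypothesis gives a_0 / a_(-2) >= mu^2. *)
Lemma psd_ge_of_norm_ge n (L : 'M[R]_n) (mu : R) (v : 'cV[R]_n) : 0 < mu ->
  L^T = L -> (forall x : 'cV[R]_n, 0 <= mxdot x (L *m x)) ->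
  (forall x : 'cV[R]_n, mu * fro x <= fro (L *m x)) ->
  mu * mxdot v v <= mxdot v (L *m v).
Proof.
move=> mu0 Lsym Lpos Lmu.
have Lunit : L \in unitmx.
  rewrite -row_free_unit -kermx_eq0; apply/eqP/row_matrixP => i; rewrite row0.
  have : row i (kermx L) *m L = 0 by rewrite -row_mul mulmx_ker row0.
  move/(congr1 trmx); rewrite trmx_mul Lsym trmx0 => kL.
  have := Lmu (row i (kermx L))^T.
  rewrite kL {2}/fro mxdot0 sqrtr0 pmulr_rle0// => fle.
  have f0 : fro (row i (kermx L))^T = 0.
    by apply: le_anti; rewrite fle fro_ge0.
  have /mxdot_eq0/(congr1 trmx) : mxdot (row i (kermx L))^T (row i (kermx L))^T
    = 0.
    by rewrite -sqr_fro f0 expr0n.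
  by rewrite trmxK trmx0.
have [u ->] : exists u, v = L *m u.
  by exists (invmx L *m v); rewrite mulmxA mulmxV// mul1mx.
have h1 : mxdot u (L *m u) ^+ 2 <= mxdot u u * mxdot (L *m u) (L *m u).
  rewrite -!sqr_fro -exprMn -[leLHS](real_normK (num_real _)).
  by rewrite ler_sqr ?nnegrE ?mulr_ge0 ?fro_ge0// cauchy_schwarz_fro.
have h2 := semidef_cauchy_schwarz u (L *m u) Lsym Lpos.
rewrite {1}(mxdot_mulr L (L *m u) u) Lsym in h2.
have h3 : mu ^+ 2 * mxdot u u <= mxdot (L *m u) (L *m u).
  rewrite -!sqr_fro -exprMn.
  by rewrite ler_sqr ?nnegrE ?mulr_ge0 ?fro_ge0 ?(ltW mu0)//; exact: Lmu.
have := Lpos (L *m u); have := Lpos u; have := mxdot_ge0 u.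
have := mxdot_ge0 (L *m u); move: h1 h2 h3.
move: (mxdot u u) (mxdot (L *m u) (L *m u)) (mxdot u (L *m u)).
move: (mxdot (L *m u) (L *m (L *m u))) => c x a b.
(* x, b, a, c are now a_(-2), a_(-1), a_0, a_1 *)
move=> h1 h2 h3 a0 x0 b0 c0.
have [->|an0] := eqVneq a 0; first by rewrite mulr0.
have {an0} a0' : 0 < a by rewrite lt0r an0.
rewrite -ler_sqr ?nnegrE ?mulr_ge0 ?(ltW mu0)// exprMn.
have h4 : a ^+ 4 <= b ^+ 2 * c ^+ 2.
  have -> : a ^+ 4 = (a ^+ 2) ^+ 2 by rewrite -exprM.
  by rewrite -exprMn ler_sqr ?nnegrE ?exprn_ge0 ?mulr_ge0.
have h5 : b ^+ 2 * c ^+ 2 <= x * a * c ^+ 2 by rewrite ler_wpM2r ?sqr_ge0.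
have h6 : mu ^+ 2 * a ^+ 4 <= a * a * c ^+ 2.
  apply: (@le_trans _ _ (mu ^+ 2 * (x * a * c ^+ 2))).
    by rewrite ler_wpM2l ?sqr_ge0// (le_trans h4).
  have -> : mu ^+ 2 * (x * a * c ^+ 2) = (mu ^+ 2 * x) * (a * c ^+ 2) by ring.
  have -> : a * a * c ^+ 2 = a * (a * c ^+ 2) by ring.
  by rewrite ler_wpM2r// mulr_ge0// sqr_ge0.
rewrite -(@ler_pM2l _ (a ^+ 2)) ?exprn_gt0//.
by apply: le_trans (le_trans h6 _); rewrite ?le_eqVlt; apply/orP; left;
  apply/eqP; ring.
Qed.

End FrobeniusProduct.

(** * Correlation of a point with the planted signal *)

Section Residual.
Context {R : rcfType}.

Lemma mxdot_mul_le n p q (A : 'M[R]_(n, p)) (X : 'M[R]_(p, q)) :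
  mxdot (A *m X) (A *m X) <= mxdot A A * mxdot X X.
Proof.
rewrite (mxdot_cols (A *m X)) (mxdot_cols X) mulr_sumr; apply: ler_sum => j _.
rewrite (colE j (A *m X)) -mulmxA -colE -!sqr_fro -exprMn.
by rewrite ler_sqr ?nnegrE ?mulr_ge0 ?fro_ge0// fro_mul_col.
Qed.

Lemma mxdot_tr n p (A B : 'M[R]_(n, p)) : mxdot A^T B^T = mxdot A B.
Proof. by rewrite /mxdot trmxK mxtrace_mulC -mxtrace_tr trmx_mul trmxK. Qed.

(** The component of O orthogonal to the columns of T, when T^T T = mu I. *)
Definition residual n r (mu : R) (T O : 'M[R]_(n, r)) :=
  O - mu^-1 *: (T *m (T^T *m O)).

Section OnePair.
Variables (n r : nat) (mu : R) (T O : 'M[R]_(n, r)).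
Hypotheses (mu0 : 0 < mu) (TT : T^T *m T = mu%:M) (OO : O^T *m O = mu%:M).

Let muN0 : mu != 0. Proof. by rewrite gt_eqF. Qed.
Local Notation K := (T^T *m O).
Local Notation Z := (residual mu T O).

Lemma mul_residual : T^T *m Z = 0.
Proof.
rewrite /residual mulmxBr -scalemxAr (mulmxA T^T T) TT mul_scalar_mx scalerA
  mulVf//.
by rewrite scale1r subrr.
Qed.

Lemma residual_gram : Z^T *m Z = mu%:M - mu^-1 *: (K^T *m K).
Proof.
have -> : Z^T = O^T - mu^-1 *: (T *m K)^T by rewrite /residual linearB linearZ.
rewrite mulmxBl -scalemxAl trmx_mul -mulmxA mul_residual.
rewrite mulmx0 scaler0 subr0 /residual mulmxBr OO -scalemxAr.
by rewrite trmx_mul trmxK !mulmxA.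
Qed.

Lemma mxdot_residual : mxdot Z Z = mu * r%:R - mu^-1 * mxdot K K.
Proof.
by rewrite /mxdot residual_gram raddfB/= mxtrace_scalar mxtraceZ mulr_natr.
Qed.

Lemma mxdot_corr_mul p (X : 'M[R]_(r, p)) :
  mxdot (K *m X) (K *m X) = mu ^+ 2 * mxdot X X - mu * mxdot (Z *m X) (Z *m X).
Proof.
rewrite !(mxdot_mull _ X) (mulmxA K^T) (mulmxA Z^T) residual_gram mulmxBl
  mxdotDr mxdotNr.
rewrite mul_scalar_mx mxdotZr -scalemxAl mxdotZr; field.
by [].
Qed.

(** A small residual makes T^T O nearly mu times an isometry. *)
Lemma corr_mul_ge p (X : 'M[R]_(r, p)) :
  (mu ^+ 2 - mu * mxdot Z Z) * mxdot X X <= mxdot (K *m X) (K *m X).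
Proof.
rewrite mxdot_corr_mul mulrBl lerB// -mulrA ler_pM2l//.
exact: mxdot_mul_le.
Qed.

End OnePair.

Variables (n r : nat) (mu w : R) (T O : 'M[R]_(n, r)) (W : 'M[R]_n).
Hypotheses (mu0 : 0 < mu) (TT : T^T *m T = mu%:M) (OO : O^T *m O = mu%:M).
Hypotheses (w0 : 0 <= w) (Wsym : W^T = W) (bW : quad_bounded w W).

Let muN0 : mu != 0. Proof. by rewrite gt_eqF. Qed.
Local Notation K := (T^T *m O).
Local Notation Z := (residual mu T O).
Local Notation S := (T *m T^T + W).

(** The roles of T and O can be exchanged, because K and K^T have the same
    Frobenius norm; hence both K and K^T are bounded below. *)
Lemma mxdot_residualC : mxdot (residual mu O T) (residual mu O T) = mxdot Z Z.
Proof.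
by rewrite !mxdot_residual// -(mxdot_tr (O^T *m T)) trmx_mul trmxK.
Qed.

Lemma corr_tr_mul_ge p (X : 'M[R]_(r, p)) :
  (mu ^+ 2 - mu * mxdot Z Z) * mxdot X X <= mxdot (K^T *m X) (K^T *m X).
Proof.
by rewrite -mxdot_residualC trmx_mul trmxK corr_mul_ge.
Qed.

Lemma mxdot_signal p (X : 'M[R]_(n, p)) :
  mxdot X (S *m X) = mxdot (T^T *m X) (T^T *m X) + mxdot X (W *m X).
Proof. by rewrite mulmxDl mxdotDr -mulmxA mxdot_mulr. Qed.

(** By [residual_gram] for the exchanged pair, I - K K^T / mu^2 is 1 / mu times
    the Gram matrix of the residual of T, so replacing T by the projection T K /
    mu of O changes the noise by a term quadratic in the residual only. *)
Lemma mxdot_noise_signal :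
  mxdot T (W *m T) - mu ^-2 * mxdot (T *m K) (W *m (T *m K)) =
  mu^-1 * mxdot (T *m (residual mu O T)^T) (W *m (T *m (residual mu O T)^T)).
Proof.
set Y := residual mu O T; pose H := T^T *m W *m T.
have KK : K *m K^T = (mu ^+ 2)%:M - mu *: (Y^T *m Y).
  rewrite /Y residual_gram// scalerBr scale_scalar_mx -expr2.
  by rewrite scalerA mulfV// scale1r subKr !trmx_mul !trmxK.
have tr_H p (X : 'M[R]_(r, p)) : mxdot (T *m X) (W *m (T *m X)) = \tr (H *m (X
  *m X^T)).
  by rewrite mxdot_mull /mxdot !mulmxA [RHS]mxtrace_mulC !mulmxA.
rewrite !tr_H trmxK KK mulmxBr raddfB/= mulmxDr mulmxN -scalemxAr mul_mx_scalar.
rewrite raddfB/= !mxtraceZ.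
have -> : mxdot T (W *m T) = \tr H by rewrite /mxdot mulmxA.
by field.
Qed.

(** The signal lost, mu |Z|^2, is at most the noise gained. Expanding O as T K /
    mu + Z, the noise has two terms of order w |Z|^2 and a cross term of order w
    |Z| |O|; dividing by |Z| leaves a linear bound. *)
Lemma residual_le : mxdot T (S *m T) <= mxdot O (S *m O) ->
  (mu - 2 * w) * fro Z <= 2 * w * Num.sqrt (mu * r%:R).
Proof.
rewrite !mxdot_signal TT => gain.
have OE : O = mu^-1 *: (T *m K) + Z by rewrite addrC subrK.
have TK : mxdot (T *m K) (T *m K) = mu * mxdot K K.
  by rewrite mxdot_mull mulmxA TT mul_scalar_mx mxdotZr.
have ZE := mxdot_residual mu0 TT OO.
have OWO : mxdot O (W *m O) = mu ^-2 * mxdot (T *m K) (W *m (T *m K)) +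
    2 * mu^-1 * mxdot Z (W *m (T *m K)) + mxdot Z (W *m Z).
  move: (residual mu T O) OE => z OE; rewrite {1 2}OE mulmxDr -scalemxAr
    !mxdotDl !mxdotDr !mxdotZl !mxdotZr.
  have -> : mxdot (T *m K) (W *m z) = mxdot z (W *m (T *m K)).
    by rewrite mxdot_mulr Wsym mxdotC.
  by field.
have h1 := quad_bounded_mx (T *m (residual mu O T)^T) bW.
have TY : mxdot (T *m (residual mu O T)^T) (T *m (residual mu O T)^T) = mu *
  mxdot Z Z.
  by rewrite mxdot_mull (mulmxA T^T) TT mul_scalar_mx mxdotZr mxdot_tr
    mxdot_residualC.
rewrite TY in h1.
have h2 := quad_bounded_mx Z bW.
have h3 := quad_bounded_bilinear Z (T *m K) w0 Wsym bW.
have mu_r : mxdot (mu%:M : 'M[R]_r) mu%:M = mu ^+ 2 * r%:R.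
  by rewrite -(scalemx1 r mu) mxdotZl mxdotZr /mxdot trmx1 mul1mx mxtrace1
    mulrA.
rewrite mu_r in gain.
have h0 := mxdot_noise_signal.
have froTK : fro (T *m K) <= mu * Num.sqrt (mu * r%:R).
  rewrite fro_le ?mulr_ge0 ?sqrtr_ge0 ?(ltW mu0)// exprMn sqr_sqrtr; last first.
    by rewrite mulr_ge0 ?(ltW mu0).
  have zz := mxdot_ge0 Z; rewrite ZE subr_ge0 in zz.
  rewrite TK expr2 -mulrA ler_pM2l//.
  by rewrite -(ler_pM2l mu0) mulVKf in zz.
have [->|fN0] := eqVneq (fro Z) 0.
  by rewrite mulr0 !mulr_ge0 ?sqrtr_ge0.
have f0 : 0 < fro Z by rewrite lt0r fN0 fro_ge0.
rewrite -(ler_pM2l f0).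
have h4 : fro Z * (w * fro (T *m K)) <= fro Z * (w * (mu * Num.sqrt (mu *
  r%:R))).
  by rewrite !ler_wpM2l ?(ltW f0).
move: h1 h2 h3 h4 gain OWO h0 ZE; rewrite -!(sqr_fro Z).
set q := Num.sqrt _; set kk := mxdot K K; set f := fro Z.
set a := mxdot T (W *m T); set b := mxdot _ (W *m (T *m (residual mu O T)^T)).
set c := mxdot Z (W *m Z); set e := mxdot Z (W *m (T *m K)); set g := fro (T *m
  K).
set h := mxdot (T *m K) _; set o := mxdot O _.
rewrite !ler_norml => /andP[h1 _] /andP[_ h2] /andP[_ h3] h4 gain oE h0 ZE.
have kkE : kk = mu ^+ 2 * r%:R - mu * f ^+ 2 by rewrite ZE; field.
have h1' : - (w * f ^+ 2) <= mu^-1 * b.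
  by rewrite -(ler_pM2l mu0) mulVKf//; move: h1; rewrite mulrCA mulrN.
have h3' : mu^-1 * e <= w * (f * q).
  rewrite -(ler_pM2l mu0) mulVKf//; apply: (le_trans h3).
  by apply: le_trans (le_trans _ h4) _; rewrite le_eqVlt; apply/orP; left;
    apply/eqP; ring.
have : mu * f ^+ 2 <= w * f ^+ 2 + 2 * (w * (f * q)) + w * f ^+ 2.
  have -> : mu * f ^+ 2 = mu ^+ 2 * r%:R - kk by rewrite kkE; ring.
  have e2 : 2 * mu^-1 * e = 2 * (mu^-1 * e) by ring.
  rewrite e2 in oE; lra.
by move=> H; lra.
Qed.

(** If O^T X = 0 then K^T (T^T X) = - mu Z^T X is small, and K^T is bounded
    below, so T^T X is small. *)
Lemma signal_orth_le p (X : 'M[R]_(n, p)) : O^T *m X = 0 ->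
  (mu ^+ 2 - mu * mxdot Z Z) * mxdot (T^T *m X) (T^T *m X)
    <= mu ^+ 2 * mxdot Z Z * mxdot X X.
Proof.
move=> OX; apply: le_trans (corr_tr_mul_ge _) _.
have -> : K^T *m (T^T *m X) = - mu *: (Z^T *m X).
  have -> : Z^T = O^T - mu^-1 *: (T *m K)^T by rewrite /residual linearB
    linearZ.
  rewrite mulmxBl OX sub0r -scalemxAl scalerN scaleNr.
  by rewrite opprK scalerA mulfV// scale1r mulmxA -trmx_mul.
rewrite mxdotZl mxdotZr mulrA mulrNN -expr2 -mulrA ler_pM2l ?exprn_gt0//.
by rewrite -(mxdot_tr Z); exact: mxdot_mul_le.
Qed.

End Residual.

(** * Optimality certificate for critical points *)

Section Blocks.
Context {R : realType} {m : nat} {d : 'I_m -> nat} {r : nat}.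
Local Notation D := (\sum_i d i)%N.
Implicit Types (O : forall i, 'M[R]_(d i, r)).

Lemma mxdot_blocks p (X Y : 'M[R]_(D, p)) :
  mxdot X Y = \sum_i mxdot (submxcol X i) (submxcol Y i).
Proof.
rewrite /mxdot -{1}(submxcolK X) -{1}(submxcolK Y) tr_mxcol mul_mxrow_mxcol.
by rewrite raddf_sum.
Qed.

Lemma feasible_gram O : otsm_feasible O ->
  (\mxcol_i O i)^T *m (\mxcol_i O i) = m%:R%:M.
Proof.
move=> fO; rewrite tr_mxcol mul_mxrow_mxcol.
rewrite (eq_bigr (fun=> 1%:M)) => [|i _]; last exact: fO.
by rewrite sumr_const card_ord -scaler_nat scalemx1.
Qed.

Lemma submxcol_mulmx (S : 'M[R]_D) O i :
  submxcol (S *m \mxcol_j O j) i = \sum_j submxblock S i j *m O j.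
Proof. by rewrite -{1}(submxblockK S) mul_mxblock_mxrow mxcolK. Qed.

(** Theta_i placed in the rows of block i and zero elsewhere; the factor written
    as a scalar avoids transporting Theta_i along an equality of indices. *)
Definition block_embed (T : forall i, 'M[R]_(d i, r)) i : 'M[R]_(D, r) :=
  \mxcol_j ((j == i)%:R *: T j).

Lemma block_embed_mul T i p (Y : 'M[R]_(D, p)) :
  (block_embed T i)^T *m Y = (T i)^T *m submxcol Y i.
Proof.
rewrite -{1}(submxcolK Y) /block_embed tr_mxcol mul_mxrow_mxcol (bigD1 i)//=
  eqxx scale1r.
by rewrite big1 ?addr0// => j /negPf ->; rewrite scale0r trmx0 mul0mx.
Qed.

Lemma stiefel_fro n p (U : 'M[R]_(n, r)) (X : 'M[R]_(r, p)) : stiefel U ->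
  fro (U *m X) = fro X.
Proof. by move=> UU; rewrite /fro mxdot_mull mulmxA UU mul1mx. Qed.

Lemma stiefel_tr_fro n (U : 'M[R]_(n, r)) (y : 'cV[R]_n) : stiefel U ->
  fro (U^T *m y) <= fro y.
Proof.
move=> UU; have [->|N0] := eqVneq (fro (U^T *m y)) 0; first exact: fro_ge0.
have f0 : 0 < fro (U^T *m y) by rewrite lt0r N0 fro_ge0.
rewrite -(ler_pM2l f0) -expr2 sqr_fro mxdot_mull trmxK.
rewrite -{1}(stiefel_fro (U^T *m y) UU) mulrC.
exact: le_trans (ler_norm _) (cauchy_schwarz_fro _ _).
Qed.

Lemma multiplier_unique S O i L : stiefel (O i) ->
  otsm_multiplier S O i L -> L = (O i)^T *m submxcol (S *m \mxcol_j O j) i.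
Proof.
by move=> Oi [_ LE]; rewrite submxcol_mulmx -LE mulmxA Oi mul1mx.
Qed.

Lemma psdmxP n (L : 'M[R]_n) : psdmx L ->
  L^T = L /\ forall p (X : 'M[R]_(n, p)), 0 <= mxdot X (L *m X).
Proof.
move=> [Ls Lp]; split=> // p X; rewrite mxdot_cols; apply: sumr_ge0 => j _.
by rewrite (colE j (L *m X)) -mulmxA -colE -quadE.
Qed.

(** The difference is the trace of G against U^T (I - V V^T) U, and the latter
    is a Gram matrix Q^T Q since I - V V^T is a projection. *)
Lemma psd_trace_compress n (G : 'M[R]_r) (U V : 'M[R]_(n, r)) :
  (forall x : 'cV[R]_r, 0 <= mxdot x (G *m x)) ->
  stiefel U -> stiefel V ->
  mxdot V (U *m G *m U^T *m V) <= \tr G.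
Proof.
move=> Gp UU VV; pose Q := U - V *m (V^T *m U).
have QQ : Q^T *m Q = 1%:M - U^T *m V *m V^T *m U.
  have VQ : V^T *m Q = 0 by rewrite mulmxBr !mulmxA VV mul1mx subrr.
  have -> : Q^T = U^T - (V^T *m U)^T *m V^T by rewrite linearB/= trmx_mul.
  rewrite mulmxBl -(mulmxA _ V^T Q) VQ mulmx0 subr0 mulmxBr UU !mulmxA.
  by [].
have : 0 <= mxdot Q^T (G *m Q^T).
  rewrite mxdot_cols; apply: sumr_ge0 => j _.
  by rewrite (colE j (G *m _)) -mulmxA -colE.
rewrite /mxdot trmxK mulmxA mxtrace_mulC mulmxA QQ mulmxBl mul1mx raddfB/=
  subr_ge0.
by rewrite -!mulmxA mxtrace_mulC -!mulmxA mxtrace_mulC -!mulmxA.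
Qed.

(** Weak duality. T - S is nonnegative, so the objective of a feasible V is at
    most tr (V^T T V). In each block T has the eigenvalues of Lambda_i on the
    range of O_i and mu, which is no larger, on the complement; hence tr (V^T T
    V) is largest at V = O, where T and S agree. *)
Section Certificate.
Variables (S : 'M[R]_D) (O : forall i, 'M[R]_(d i, r)) (L : 'I_m -> 'M[R]_r)
  (mu : R).
Hypotheses (m0 : (0 < m)%N) (fO : otsm_feasible O) (Ssym : S^T = S).
Hypothesis multL : forall i, otsm_multiplier S O i (L i).
Hypothesis Lmu : forall i (x : 'cV[R]_r), mu * mxdot x x <= mxdot x (L i *m x).
Hypothesis Smu : forall X : 'M[R]_(D, r), (\mxcol_i O i)^T *m X = 0 ->
  mxdot X (S *m X) <= mu * mxdot X X.

Let G i := L i - mu%:M.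
Let Tb i := O i *m G i *m (O i)^T + mu%:M.
Let T := \mxdiag_i Tb i.
Let Os := \mxcol_i O i.

Let Gpos i p (x : 'M[R]_(r, p)) : 0 <= mxdot x (G i *m x).
Proof.
rewrite mxdot_cols; apply: sumr_ge0 => j _.
rewrite (colE j (G i *m _)) -mulmxA -colE.
by rewrite mulmxBl mul_scalar_mx mxdotDr mxdotNr mxdotZr subr_ge0.
Qed.

Let Gsym i : (G i)^T = G i.
Proof. by rewrite linearB/= tr_scalar_mx (multL i).1. Qed.

Let Tsym : T^T = T.
Proof.
rewrite /T tr_mxdiag; apply/eq_mxdiag => i.
by rewrite /Tb linearD/= tr_scalar_mx !trmx_mul trmxK Gsym mulmxA.
Qed.

Let TO : T *m Os = S *m Os.
Proof.
rewrite /T /Os mul_mxdiag_mxcol -[RHS]submxcolK; apply/eq_mxcol => i.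
rewrite submxcol_mulmx -(multL i).2 /Tb mulmxDl -mulmxA fO mulmx1 mul_scalar_mx.
by rewrite /G mulmxBr mul_mx_scalar subrK.
Qed.

Let T_quad p (X : 'M[R]_(D, p)) : mxdot X (T *m X) =
  \sum_i mxdot (submxcol X i) (Tb i *m submxcol X i).
Proof.
rewrite mxdot_blocks; apply: eq_bigr => i _.
by rewrite -{2}(submxcolK X) mul_mxdiag_mxcol mxcolK.
Qed.

Let T_ge p (X : 'M[R]_(D, p)) : mu * mxdot X X <= mxdot X (T *m X).
Proof.
rewrite T_quad mxdot_blocks mulr_sumr; apply: ler_sum => i _.
rewrite /Tb mulmxDl mul_scalar_mx mxdotDr mxdotZr lerDr.
by rewrite -!mulmxA mxdot_mulr.
Qed.

Let T_feasible (V : forall i, 'M[R]_(d i, r)) : otsm_feasible V ->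
  mxdot (\mxcol_i V i) (T *m \mxcol_i V i) <= \sum_i \tr (L i).
Proof.
move=> fV; rewrite T_quad; apply: ler_sum => i _; rewrite mxcolK.
rewrite /Tb mulmxDl mul_scalar_mx mxdotDr mxdotZr.
have -> : mxdot (V i) (V i) = r%:R by rewrite /mxdot fV mxtrace1.
have -> : \tr (L i) = \tr (G i) + mu * r%:R.
  by rewrite /G raddfB/= mxtrace_scalar mulr_natr subrK.
by rewrite lerD2r psd_trace_compress//; exact: Gpos.
Qed.

Let value_O : mxdot Os (S *m Os) = \sum_i \tr (L i).
Proof.
rewrite mxdot_blocks; apply: eq_bigr => i _.
by rewrite submxcol_mulmx -(multL i).2 mxcolK /mxdot mulmxA fO mul1mx.
Qed.

Lemma certificate_global_optimum : otsm_global_optimum S O.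
Proof.
split=> // V fV; rewrite !otsm_objectiveE.
have trE (Y : forall i, 'M[R]_(d i, r)) : \tr ((\mxcol_i Y i)^T *m S *m
  \mxcol_i Y i) = mxdot (\mxcol_i Y i) (S *m \mxcol_i Y i).
  by rewrite /mxdot mulmxA.
rewrite !trE value_O.
apply: le_trans (T_feasible fV).
set Vs := \mxcol_i V i; pose X := residual m%:R Os Vs.
have mR : 0 < m%:R :> R by rewrite ltr0n.
have OX : Os^T *m X = 0 by apply: mul_residual => //; exact: feasible_gram.
have VE : Vs = Os *m (m%:R^-1 *: (Os^T *m Vs)) + X.
  by rewrite -scalemxAr addrC subrK.
move: VE OX; move: X (m%:R^-1 *: _) => X C -> OX.
(* T - S is symmetric and annihilates O, so it only sees the component X *)
rewrite -subr_ge0 -mxdotNr -mxdotDr -mulNmx -mulmxDl.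
have NO : (T - S) *m Os = 0 by rewrite mulmxBl TO subrr.
have Nsym : (T - S)^T = T - S by rewrite linearB/= Tsym Ssym.
rewrite mulmxDr mulmxA NO mul0mx add0r mxdotDl.
rewrite mxdot_mulr Nsym mulmxA NO mul0mx mxdotC mxdot0 add0r.
by rewrite mulmxBl mxdotDr mxdotNr subr_ge0 (le_trans (Smu OX)).
Qed.
End Certificate.

(** With s = sqrt mu and q = w sqrt rr, the hypotheses give f <= (14/5) q / s
    and q^2 <= s^3 / 38; the constants then use s >= 7/5, that is mu >= 2. *)
Lemma residual_bounds (mu w f rr : R) : 2 <= mu -> 0 <= w -> 0 <= f -> 1 <= rr
  ->
  7 * w <= mu -> 38 * (w ^+ 2 * rr) <= mu * Num.sqrt mu ->
  (mu - 2 * w) * f <= 2 * w * Num.sqrt (mu * rr) ->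
  f ^+ 2 <= 15 / 100 * mu /\ w * f <= 8 / 100 * mu.
Proof.
move=> mu2 w0 f0 rr1 w7 w38.
have mu0 : 0 <= mu by lra.
rewrite sqrtrM//; move: w38.
have : Num.sqrt rr ^+ 2 = rr by rewrite sqr_sqrtr//; lra.
have : 0 <= Num.sqrt rr by exact: sqrtr_ge0.
have : Num.sqrt mu ^+ 2 = mu by rewrite sqr_sqrtr.
have : 0 <= Num.sqrt mu by exact: sqrtr_ge0.
move: (Num.sqrt mu) (Num.sqrt rr) => s t s0 s2 t0 t2 w38 hf.
have t1 : 1 <= t by rewrite -(@ler_sqr _ 1 t) ?nnegrE// expr1n t2.
pose q := w * t.
have q0 : 0 <= q by rewrite mulr_ge0.
have sgt : 7 / 5 <= s.
  by rewrite -ler_sqr ?nnegrE// s2; lra.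
have sgt0 : 0 < s by lra.
have q38 : 38 * q ^+ 2 <= s ^+ 3.
  by rewrite exprMn t2 (le_trans w38)// -s2 -exprSr.
have fq : 5 / 7 * s * f <= 2 * q.
  rewrite -(ler_pM2l sgt0).
  have -> : s * (5 / 7 * s * f) = 5 / 7 * mu * f by rewrite -s2; ring.
  apply: (@le_trans _ _ ((mu - 2 * w) * f)); first by rewrite ler_wpM2r//; lra.
  by rewrite (le_trans hf)// le_eqVlt; apply/orP; left; apply/eqP; rewrite /q;
    ring.
have fq2 : s * f <= 14 / 5 * q by lra.
have f2 : s ^+ 2 * f ^+ 2 <= (14 / 5) ^+ 2 * q ^+ 2.
  by rewrite -!exprMn ler_sqr ?nnegrE ?mulr_ge0.
split.
  rewrite -(@ler_pM2l _ (s ^+ 2)) ?exprn_gt0//; apply: (le_trans f2).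
  apply: (@le_trans _ _ ((14 / 5) ^+ 2 / 38 * s ^+ 3)); first by lra.
  have -> : s ^+ 2 * (15 / 100 * mu) = s ^+ 3 * (15 / 100 * s) by rewrite -s2;
    ring.
  by rewrite mulrC ler_wpM2l ?exprn_ge0//; lra.
have wq : w <= q by rewrite ler_peMr.
rewrite -(@ler_pM2l _ s)//.
apply: (@le_trans _ _ (q * (14 / 5 * q))).
  by rewrite mulrCA ler_pM// mulr_ge0// ltW.
have -> : s * (8 / 100 * mu) = 8 / 100 * s ^+ 3 by rewrite -s2; ring.
have : 0 <= s ^+ 3 by rewrite exprn_ge0.
by move=> ?; lra.
Qed.

Lemma fro_corr_ge (mu f : R) n p (K : 'M[R]_(n, r)) (X : 'M[R]_(r, p)) : 0 <=
  mu ->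
  f <= 15 / 100 * mu ->
  (mu ^+ 2 - mu * f) * mxdot X X <= mxdot (K *m X) (K *m X) ->
  92 / 100 * mu * fro X <= fro (K *m X).
Proof.
move=> mu0 fmu KX.
have c0 : 0 <= 92 / 100 * mu by lra.
rewrite -ler_sqr ?nnegrE ?fro_ge0 ?(mulr_ge0 c0) ?fro_ge0//.
rewrite exprMn !sqr_fro (le_trans _ KX)// ler_wpM2r ?mxdot_ge0//.
by nra.
Qed.

(** The certificate is used with mu = 38 m / 100. The correlation K is bounded
    below by 92 m / 100; half of it is lost to the noise of the single block,
    and 8 m / 100 to the noise acting on the residual. On the complement of O
    the signal is at most 15 m / 85 and the noise at most m / 7, and these add
    up to less than 38 m / 100. *)
Theorem maxbet_candidate_optimal (Theta : forall i, 'M[R]_(d i, r)) (W :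
  'M[R]_D)
    (w : R) (O : forall i, 'M[R]_(d i, r)) (S := maxbet_mx Theta W) :
  (2 <= m)%N -> (1 <= r)%N -> (forall i, stiefel (Theta i)) ->
  W^T = W -> 0 <= w -> quad_bounded w W ->
  (forall i (v : 'cV[R]_r),
     fro ((block_embed Theta i)^T *m (W *m (\mxcol_i Theta i *m v)))
       <= m%:R / 2 * fro v) ->
  7 * w <= m%:R -> 38 * (w ^+ 2 * r%:R) <= m%:R * Num.sqrt m%:R ->
  otsm_candidate_critical S O ->
  \tr ((\mxcol_i Theta i)^T *m S *m \mxcol_i Theta i)
    <= \tr ((\mxcol_i O i)^T *m S *m \mxcol_i O i) ->
  otsm_global_optimum S O.
Proof.
move=> m2 r1 hT Wsym w0 bW bG w7 w38 [[fO crit] cand] gain.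
set T := \mxcol_i Theta i in bG gain *; set Os := \mxcol_i O i in gain *.
have m0 : (0 < m)%N by exact: leq_trans m2.
have mu2 : 2 <= m%:R :> R by rewrite (ler_nat _ 2).
have mu0 : 0 < m%:R :> R by rewrite ltr0n.
have r1' : 1 <= r%:R :> R by rewrite (ler_nat _ 1).
have TT : T^T *m T = m%:R%:M by exact: feasible_gram.
have OO : Os^T *m Os = m%:R%:M by exact: feasible_gram.
pose f := fro (residual m%:R T Os).
have [f2 wf] : f ^+ 2 <= 15 / 100 * m%:R /\ w * f <= 8 / 100 * m%:R.
  apply: (@residual_bounds _ _ _ r%:R) => //; first exact: fro_ge0.
  apply: (residual_le (W := W)) => //.
  by move: gain; rewrite -!mulmxA.
pose L i := (O i)^T *m submxcol (S *m Os) i.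
have multL i : otsm_multiplier S O i (L i).
  by have [Li mLi] := crit i; have := mLi; rewrite (multiplier_unique (fO i)
    mLi).
have ff : mxdot (residual m%:R T Os) (residual m%:R T Os) <= 15 / 100 * m%:R.
  by rewrite -sqr_fro.
apply: (@certificate_global_optimum S O L (38 / 100 * m%:R)) => //.
- by rewrite /S /maxbet_mx linearD/= trmx_mul trmxK Wsym.
- move=> i x; have [Lsym Lpos] := psdmxP (cand i _ (multL i)).
  apply: psd_ge_of_norm_ge => //; first by lra.
  move=> {}x.
  have -> : fro (L i *m x) = fro (submxcol (S *m Os *m x) i).
    by rewrite -(stiefel_fro _ (fO i)) mulmxA (multL i).2 -submxcol_mulmx
      submxcol_mul.
  apply: le_trans (stiefel_tr_fro _ (hT i)).
  rewrite -block_embed_mul.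
  set E := block_embed Theta i; set K := T^T *m Os.
  have ET : E^T *m T = 1%:M by rewrite block_embed_mul mxcolK hT.
  have EE : stiefel E.
    rewrite /stiefel block_embed_mul mxcolK eqxx scale1r; exact: hT.
  have SE : E^T *m (S *m Os *m x) = K *m x +
      (E^T *m (W *m (T *m (m%:R^-1 *: (K *m x)))) + E^T *m (W *m (residual m%:R
        T Os *m x))).
    rewrite -mulmxDr -mulmxDr.
    have -> : T *m (m%:R^-1 *: (K *m x)) + residual m%:R T Os *m x = Os *m x.
      by rewrite /residual mulmxBl -scalemxAl -scalemxAr -/K mulmxA addrC subrK.
    rewrite /S /maxbet_mx -/T mulmxDl mulmxDl mulmxDr -!mulmxA; congr (_ + _).
    by rewrite mulmxA ET mul1mx.
  have Kx : 92 / 100 * m%:R * fro x <= fro (K *m x).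
    by apply: (fro_corr_ge (ltW mu0) ff); exact: corr_mul_ge.
  have e1 : fro (E^T *m (W *m (T *m (m%:R^-1 *: (K *m x))))) <= 1 / 2 * fro (K
    *m x).
    apply: (le_trans (bG i _)); rewrite froZ ger0_norm ?invr_ge0 ?(ltW mu0)//.
    by rewrite le_eqVlt; apply/orP; left; apply/eqP; field; rewrite gt_eqF.
  have e2 : fro (E^T *m (W *m (residual m%:R T Os *m x))) <= w * f * fro x.
    apply: (le_trans (stiefel_tr_fro _ EE)).
    apply: (le_trans (quad_bounded_mul _ w0 Wsym bW)).
    by rewrite -mulrA ler_wpM2l// fro_mul_col.
  have e3 : w * f * fro x <= 8 / 100 * m%:R * fro x by rewrite ler_wpM2r
    ?fro_ge0.
  rewrite SE; move: e1 e2; set P := E^T *m _; set Q := E^T *m _ => e1 e2.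
  have t1 := fro_triangle (K *m x + (P + Q)) (- (P + Q)).
  have t2 := fro_triangle P Q.
  have t3 : fro (- (P + Q)) = fro (P + Q) by rewrite -scaleN1r froZ normrN1
    mul1r.
  rewrite addrK in t1.
  by lra.
- move=> X OX; rewrite mxdot_signal.
  have sig := signal_orth_le mu0 TT OO OX.
  have noise := le_trans (ler_norm _) (quad_bounded_mx X bW).
  have x0 := mxdot_ge0 X; have y0 := mxdot_ge0 (T^T *m X).
  have z0 := mxdot_ge0 (residual m%:R T Os).
  move: sig noise x0 y0 z0 ff; move: (mxdot X X) (mxdot X (W *m X)).
  move: (mxdot (T^T *m X) _) (mxdot (residual _ _ _) _) => y z x n.
  move=> sig noise x0 y0 z0 zm.
  have : 85 / 100 * y <= 15 / 100 * m%:R * x.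
    rewrite -(@ler_pM2l _ (m%:R ^+ 2)) ?exprn_gt0//.
    apply: (@le_trans _ _ ((m%:R ^+ 2 - m%:R * z) * y)).
      rewrite mulrA ler_wpM2r//.
      have : m%:R * z <= m%:R * (15 / 100 * m%:R) by rewrite ler_pM2l.
      by lra.
    apply: (le_trans sig); rewrite -mulrA ler_pM2l ?exprn_gt0//.
    by rewrite ler_wpM2r.
  have : w * x <= 1 / 7 * m%:R * x by rewrite ler_wpM2r//; lra.
  have : 0 <= m%:R * x by rewrite mulr_ge0// ltW.
  by move=> a b c; lra.
Qed.

End Blocks.

(** * A net for quadratic forms *)

Section Maximizer.
Context {R : realType}.

Lemma continuous_quad n (M : 'M[R]_n) :
  continuous (fun v : 'rV[R]_n => mxdot v^T (M *m v^T)).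
Proof.
have -> : (fun v : 'rV[R]_n => mxdot v^T (M *m v^T)) =
    (fun v => \sum_i v 0 i * \sum_j M i j * v 0 j).
  apply/funext => v; rewrite mxdotE big_ord1; apply: eq_bigr => i _.
  by rewrite !mxE; congr (_ * _); apply: eq_bigr => j _; rewrite !mxE.
apply: continuous_big; first exact: add_continuous.
have cont_coord j : continuous (fun v : 'rV[R]_n => v 0 j).
  exact: coord_continuous.
move=> i _ v; apply: continuousM; first exact: cont_coord.
move: v; apply: continuous_big; first exact: add_continuous.
move=> j _ v; apply: continuousM; first exact: cst_continuous.
exact: cont_coord.
Qed.

Lemma coord_sqr_le n (x : 'cV[R]_n) i : x i 0 ^+ 2 <= mxdot x x.
Proof.
rewrite mxdotE big_ord1 (bigD1 i)//= -expr2 lerDl.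
by apply: sumr_ge0 => j _; rewrite -expr2 sqr_ge0.
Qed.

Lemma compact_sphere n (c : R) :
  compact [set v : 'rV[R]_n | mxdot v^T v^T = c].
Proof.
pose a := c + 1.
have box : compact [set v : 'rV[R]_n | forall i, `[- a, a]%classic (v ord0 i)].
  by apply: (@rV_compact _ _ (fun=> `[- a, a]%classic)) => _; exact:
    segment_compact.
apply: subclosed_compact box _.
  have -> : [set v : 'rV[R]_n | mxdot v^T v^T = c] =
      (fun v : 'rV[R]_n => mxdot v^T (1%:M *m v^T)) @^-1` [set c].
    by apply/seteqP; split=> v /=; rewrite mul1mx.
  apply: closed_comp => [v _|]; first exact: continuous_quad.
  exact: closed_eq.
move=> v /= vc i; rewrite in_itv/=.
have := coord_sqr_le v^T i; rewrite vc mxE => h.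
have c0 : 0 <= c by rewrite -vc mxdot_ge0.
rewrite -ler_norml -ler_sqr ?nnegrE//; last by rewrite /a addr_ge0.
rewrite real_normK ?num_real// (le_trans h)// /a; nra.
Qed.

(** The form is homogeneous, so maximising its absolute value over a sphere of
    any radius maximises the Rayleigh quotient. *)
Lemma quad_maximizer n (M : 'M[R]_n) (c : R) : (0 < n)%N -> 0 < c ->
  exists2 y : 'cV[R]_n, mxdot y y = c &
    forall x : 'cV[R]_n, c * `|mxdot x (M *m x)| <= `|mxdot y (M *m y)| * mxdot
      x x.
Proof.
move=> n0 c0; pose A := [set v : 'rV[R]_n | mxdot v^T v^T = c].
pose f (v : 'rV[R]_n) := `|mxdot v^T (M *m v^T)|.
have A0 : A !=set0.
  exists (const_mx (Num.sqrt (c / n%:R))); rewrite /A/= mxdotE big_ord1.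
  under eq_bigr do rewrite !mxE -expr2 sqr_sqrtr ?divr_ge0 ?(ltW c0)//.
  by rewrite sumr_const card_ord -[LHS]mulr_natr divfK// pnatr_eq0 -lt0n.
have cf : {within A, continuous f}.
  apply: continuous_subspaceT => v; apply: cvg_comp; last exact:
    norm_continuous.
  exact: continuous_quad.
have [y /set_mem yc ymax] := EVT_max_rV A0 (@compact_sphere n c) cf.
exists y^T => // x.
have [x0|xN0] := eqVneq (mxdot x x) 0.
  by rewrite x0 (mxdot_eq0 x0) mulmx0 mxdot0 normr0 !mulr0.
have {xN0} x0 : 0 < mxdot x x by rewrite lt0r xN0 mxdot_ge0.
pose k := Num.sqrt (c / mxdot x x).
have k2 : k ^+ 2 = c / mxdot x x by rewrite sqr_sqrtr// divr_ge0 ?ltW.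
have := ymax (k *: x)^T.
rewrite /f trmxK -scalemxAr !mxdotZl !mxdotZr => H.
have /H : (k *: x)^T \in A.
  rewrite inE /A/= trmxK mxdotZl mxdotZr mulrA -expr2 k2 divfK// gt_eqF//.
rewrite mulrA -expr2 k2 normrM ger0_norm ?divr_ge0 ?(ltW c0) ?(ltW x0)//.
by rewrite mulrAC ler_pdivrMr.
Qed.

Definition round_cV n (y : 'cV[R]_n) : 'cV[R]_n :=
  \col_i (Num.floor (y i 0 + 1 / 2))%:~R.

Lemma round_dist n (y : 'cV[R]_n) :
  mxdot (round_cV y - y) (round_cV y - y) <= n%:R / 4.
Proof.
rewrite mxdotE big_ord1.
have -> : n%:R / 4 = \sum_(i < n) (1 / 4) :> R.
  by rewrite sumr_const card_ord -[RHS]mulr_natl mul1r.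
apply: ler_sum => i _; rewrite !mxE.
have /andP[] := floor_itv (y i 0 + 1 / 2).
rewrite intrD mulr1z; move: (Num.floor _) => k.
by move: (k%:~R) (y i ord0) => a b h1 h2; nra.
Qed.

(** Let y maximise |x^T M x| on the sphere |x|^2 = 25 n / 4, with Rayleigh
    quotient la in absolute value and s the sign of the form at y. Then B = la -
    s M is positive semidefinite and y is in its kernel. Rounding y moves it by
    at most sqrt n / 2, so the rounded point z has z^T B z = (z - y)^T B (z - y)
    <= la n / 2, second order in the displacement, while 2 sqrt n <= |z| <= 3
    sqrt n. At |z|^2 = 4 n the loss la n / 2 is one eighth of la |z|^2. *)
Lemma quad_bounded_of_round n (M : 'M[R]_n) (t : R) : (0 < n)%N -> 0 <= t ->
  M^T = M ->
  (forall y : 'cV[R]_n, let z := round_cV y in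
     4 * n%:R <= mxdot z z <= 9 * n%:R ->
     `|mxdot z (M *m z)| <= 7 / 8 * t * mxdot z z) ->
  quad_bounded t M.
Proof.
move=> n0 t0 Msym Hnet.
have nR : 0 < n%:R :> R by rewrite ltr0n.
have c0 : 0 < 25 / 4 * n%:R :> R by rewrite mulr_gt0.
have [y yc ymax] := quad_maximizer M n0 c0.
pose la := `|mxdot y (M *m y)| / (25 / 4 * n%:R).
have la0 : 0 <= la by rewrite divr_ge0// ltW.
have bla : quad_bounded la M.
  by move=> x; rewrite /la mulrAC ler_pdivlMr// mulrC.
suff lat : la <= t.
  by move=> x; rewrite (le_trans (bla x))// ler_wpM2r ?mxdot_ge0.
pose s : R := if 0 <= mxdot y (M *m y) then 1 else -1.
have ns : `|s| = 1 by rewrite /s; case: ifP; rewrite ?normrN normr1.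
have sy : s * mxdot y (M *m y) = la * mxdot y y.
  rewrite yc /la divfK ?gt_eqF// /s; case: ifPn => [h|]; first by rewrite mul1r
    ger0_norm.
  by rewrite -ltNge => h; rewrite mulN1r ltr0_norm.
pose B := la%:M - s *: M.
have BE (u v : 'cV[R]_n) : mxdot u (B *m v) = la * mxdot u v - s * mxdot u (M
  *m v).
  by rewrite mulmxBl mul_scalar_mx -scalemxAl mxdotDr mxdotNr !mxdotZr.
have sle (x : R) : s * x <= `|x|.
  by rewrite (le_trans (ler_norm _))// normrM ns mul1r.
have sge (x : R) : - `|x| <= s * x.
  by rewrite lerNl -mulrN (le_trans (sle _))// normrN.
have Bsym : B^T = B by rewrite linearB/= linearZ/= tr_scalar_mx Msym.
have Bpos (x : 'cV[R]_n) : 0 <= mxdot x (B *m x).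
  by rewrite BE subr_ge0 (le_trans (sle _)).
have By (x : 'cV[R]_n) : mxdot x (B *m y) = 0.
  have := semidef_cauchy_schwarz x y Bsym Bpos.
  rewrite (BE y y) sy subrr mulr0 => h.
  by apply/eqP; rewrite -sqrf_eq0; apply/eqP/le_anti; rewrite h sqr_ge0.
set z := round_cV y; have dz := round_dist y; rewrite -/z in dz.
have zE : z = y + (z - y) by rewrite addrC subrK.
have zB : mxdot z (B *m z) = mxdot (z - y) (B *m (z - y)).
  rewrite {1 2}zE mulmxDr !mxdotDl !mxdotDr !By.
  by rewrite (mxdot_mulr B _ y) Bsym mxdotC By !add0r.
have zBle : mxdot z (B *m z) <= 2 * la * (n%:R / 4).
  rewrite zB BE; have h := sge (mxdot (z - y) (M *m (z - y))).
  have h2 := bla (z - y).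
  apply: (@le_trans _ _ (2 * la * mxdot (z - y) (z - y))); last first.
    by rewrite ler_wpM2l// mulr_ge0.
  by lra.
pose q := Num.sqrt (n%:R : R).
have q0 : 0 <= q by exact: sqrtr_ge0.
have q2 : q ^+ 2 = n%:R by rewrite sqr_sqrtr// ltW.
have fy : fro y = 5 / 2 * q.
  have f0 := fro_ge0 y; apply/eqP; rewrite -(@eqrXn2 _ 2)//; last by rewrite
    mulr_ge0.
  by rewrite sqr_fro yc -q2; apply/eqP; field.
have fd : fro (z - y) <= 1 / 2 * q.
  rewrite fro_le ?mulr_ge0// (le_trans dz)// exprMn q2.
  by rewrite le_eqVlt; apply/orP; left; apply/eqP; field.
have z9 : mxdot z z <= 9 * n%:R.
  have -> : 9 * n%:R = (3 * q) ^+ 2 :> R by rewrite exprMn q2; ring.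
  rewrite -fro_le ?mulr_ge0// zE (le_trans (fro_triangle _ _))//.
  by move: fd fy; lra.
have z4 : 4 * n%:R <= mxdot z z.
  have -> : 4 * n%:R = (2 * q) ^+ 2 :> R by rewrite exprMn q2; ring.
  rewrite -sqr_fro ler_sqr ?nnegrE ?mulr_ge0 ?fro_ge0//.
  have := fro_triangle z (- (z - y)).
  have -> : fro (- (z - y)) = fro (z - y) by rewrite -scaleN1r froZ normrN1
    mul1r.
  have -> : z - (z - y) = y by rewrite opprB addrC subrK.
  by rewrite fy; move: fd; lra.
have /Hnet : 4 * n%:R <= mxdot z z <= 9 * n%:R by rewrite z4 z9.
rewrite -/z => hz.
have hz2 := sle (mxdot z (M *m z)).
rewrite BE in zBle.
have key : (la - 7 / 8 * t) * mxdot z z <= la * n%:R / 2 by lra.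
rewrite leNgt; apply/negP => tla.
have : (la - 7 / 8 * t) * (4 * n%:R) <= la * n%:R / 2.
  by rewrite (le_trans _ key)// ler_wpM2l//; lra.
have : t * n%:R < la * n%:R by rewrite ltr_pM2r.
by lra.
Qed.

End Maximizer.

Section Grid.
Context {R : realType}.

(** An integer vector with squared norm at most 9 n has entries in [-3n, 3n];
    they are stored shifted by 3n, and the size is written as a sum so that sums
    over it split at the origin. *)
Definition grid_index n := {ffun 'I_n -> 'I_((3 * n).+1 + 3 * n)}.

Definition grid_point n (k : grid_index n) : 'cV[R]_n :=
  \col_i ((k i)%:R - (3 * n)%:R).

Definition shell n : {set grid_index n} :=
  [set k | 4 * n%:R <= mxdot (grid_point k) (grid_point k) <= 9 * n%:R].

Lemma round_grid n (y : 'cV[R]_n) : (0 < n)%N ->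
  mxdot (round_cV y) (round_cV y) <= 9 * n%:R ->
  exists k : grid_index n, round_cV y = grid_point k.
Proof.
move=> n0 h.
pose f i := Num.floor (y i 0 + 1 / 2).
have fb i : - (3 * n)%N%:Z <= f i <= (3 * n)%N%:Z.
  have := le_trans (coord_sqr_le (round_cV y) i) h.
  rewrite mxE -/(f i) => h2.
  have : `|(f i)%:~R : R| <= (3 * n)%:R.
    rewrite -ler_sqr ?nnegrE// real_normK ?num_real// (le_trans h2)//.
    rewrite natrM exprMn -natrX ler_pM// -?natrX ?ler_nat//.
    by rewrite -mulnn leq_pmulr.
  by rewrite -intr_norm -[(3 * n)%:R]/((3 * n)%N%:~R) ler_int -ler_norml.
exists [ffun i => @inord (3 * n + 3 * n) (absz (f i + (3 * n)%N%:Z))].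
apply/colP => i; rewrite !mxE ffunE -/(f i).
have := fb i; move: (f i) => x /andP[h1 h2].
rewrite inordK; last first.
  by rewrite -[ltnRHS]/(3 * n + 3 * n).+1; lia.
have -> : (absz (x + (3 * n)%N%:Z))%:R = (x + (3 * n)%N%:Z)%:~R :> R.
  by rewrite -[LHS]/((absz _)%:Z%:~R) gez0_abs//; move: h1; lia.
by rewrite intrD addrK.
Qed.

Let offset n (j : 'I_((3 * n).+1 + 3 * n)) : nat := ((j - 3 * n) + (3 * n -
  j))%N.

Let offset_sqr n (j : 'I_((3 * n).+1 + 3 * n)) :
  (j%:R - (3 * n)%:R) * (j%:R - (3 * n)%:R) = (offset j ^ 2)%:R :> R.
Proof.
rewrite natrX -expr2 /offset; case: (leqP j (3 * n)%N) => h.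
  by rewrite (eqP (h : (j - 3 * n == 0)%N)) add0n natrB// -sqrrN opprB.
have h' := ltnW h; rewrite natrD natrB//.
by rewrite (eqP (h' : (3 * n - j == 0)%N)) addr0.
Qed.

Let q : R := 9 / 10.

Let geometric N : \sum_(i < N) q ^+ i <= 10.
Proof.
suff H : \sum_(i < N) q ^+ i + 10 * q ^+ N <= 10.
  by apply: le_trans H; rewrite lerDl mulr_ge0// exprn_ge0// /q; lra.
elim: N => [|N IH]; first by rewrite big_ord0 expr0; lra.
rewrite big_ord_recr/= exprS; apply: le_trans IH.
have -> : 10 * (q * q ^+ N) = 9 * q ^+ N by rewrite /q; field.
by lra.
Qed.

Let sum_offset n : \sum_(j < (3 * n).+1 + 3 * n) q ^+ offset j <= 20.
Proof.
rewrite big_split_ord/=.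
have q0 : 0 <= q by rewrite /q; lra.
have -> : 20 = 10 + 10 :> R by lra.
apply: lerD.
  rewrite (reindex_inj rev_ord_inj)/=; apply: le_trans (geometric (3 * n).+1).
  apply: ler_sum => j _; rewrite /offset/= ler_wiXn2l//; first by rewrite /q;
    lra.
  have := ltn_ord j; lia.
apply: le_trans (geometric (3 * n)).
apply: ler_sum => j _; rewrite /offset/= ler_wiXn2l//; first by rewrite /q; lra.
by lia.
Qed.

(** On the shell the l1 norm is at most the squared l2 norm, hence at most 9 n,
    so each point has weight at least q^(9 n) when z is given the weight q^|z|_1
    with q = 9/10. The weights factor over coordinates and sum to at most 20^n;
    finally 20 (10/9)^9 <= (5/4)^18 <= exp (9/2). *)
Lemma card_shell n : #|shell n|%:R <= expR (9 / 2) ^+ n :> R.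
Proof.
have q0 : 0 < q by rewrite /q; lra.
have H : #|shell n|%:R * q ^+ (9 * n) <= 20 ^+ n.
  apply: (@le_trans _ _ (\sum_(k : grid_index n) \prod_(i < n) q ^+ offset (k
    i))).
    rewrite -sum1_card natr_sum mulr_suml [leRHS](bigID (mem (shell n)))/=.
    rewrite -[leLHS]addr0; apply: lerD; last first.
      by apply: sumr_ge0 => k _; apply: prodr_ge0 => i _; rewrite exprn_ge0//
        ltW.
    apply: ler_sum => k; rewrite inE => /andP[_].
    have -> : mxdot (grid_point k) (grid_point k) = (\sum_i offset (k i) ^
      2)%:R.
      rewrite natr_sum mxdotE big_ord1; apply: eq_bigr => i _.
      by rewrite /grid_point !mxE offset_sqr.
    rewrite mul1r prodrXr.
    rewrite -natrM ler_nat => h.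
    rewrite ler_wiXn2l ?(ltW q0)//; first by rewrite /q; lra.
    apply: leq_trans h; apply: leq_sum => i _.
    by case: (offset (k i)) => // e; rewrite -mulnn leq_pmulr.
  rewrite -(bigA_distr_bigA (fun (i : 'I_n) j => q ^+ offset j)).
  rewrite prodr_const card_ord; apply: lerXn2r; rewrite ?nnegrE//.
    by rewrite sumr_ge0// => j _; rewrite exprn_ge0// ltW.
have e18 : (5 / 4) ^+ 18 <= expR (9 / 2) :> R.
  have -> : 9 / 2 = 18%:R * (1 / 4) :> R by field.
  rewrite expRM_natl ler_pXn2r ?nnegrE ?expR_ge0//.
  by apply: le_trans (expR_ge1Dx _); lra.
rewrite -(@ler_pM2r _ (q ^+ (9 * n))) ?exprn_gt0// (le_trans H)//.
have q9 : 0 <= q ^+ 9 by rewrite exprn_ge0// ltW.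
rewrite exprM -exprMn; apply: lerXn2r; rewrite ?nnegrE ?mulr_ge0 ?expR_ge0//.
apply: (@le_trans _ _ ((5 / 4) ^+ 18 * q ^+ 9)); last first.
  by rewrite ler_wpM2r.
rewrite /q; lra.
Qed.

Lemma quad_bounded_of_shell n (M : 'M[R]_n) (t : R) : (0 < n)%N -> 0 <= t ->
  M^T = M ->
  (forall k, k \in shell n ->
     `|mxdot (grid_point k) (M *m grid_point k)|
       <= 7 / 8 * t * mxdot (grid_point k) (grid_point k)) ->
  quad_bounded t M.
Proof.
move=> n0 t0 Msym net; apply: quad_bounded_of_round => // y z zn.
have /andP[_ z9] := zn; have [k zk] := round_grid n0 z9.
by rewrite /z zk; apply: net; rewrite inE -zk.
Qed.

End Grid.

(** * Gaussian tails for independent families *)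

Section Density.
Context {d1 d2 : measure_display} {T1 : measurableType d1}
  {T2 : measurableType d2} {R : realType}.
Variables (mu : {measure set T1 -> \bar R}) (nu : {measure set T2 -> \bar R}).
Variables (phi : T1 -> T2) (Y : T1 -> R) (B : set T1).
Hypotheses (mB : measurable B) (mphi : measurable_fun setT phi).
Hypotheses (mY : measurable_fun setT Y) (Y0 : forall x, 0 <= Y x).
Hypothesis nuE : forall A, measurable A ->
  (\int[mu]_(x in B `&` phi @^-1` A) (Y x)%:E = nu A)%E.

Import HBNNSimple.

Let mpre A : measurable A -> measurable (phi @^-1` A).
Proof. by move=> mA; rewrite -[_ @^-1` _]setTI; exact: mphi. Qed.

Let density_nnsfun (g : {nnsfun T2 >-> R}) :
  (\int[mu]_(x in B) (g (phi x) * Y x)%:E = \int[nu]_y (g y)%:E)%E.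
Proof.
have mg r : measurable (g @^-1` [set r]) by [].
transitivity (\sum_(r \in range g)
    \int[mu]_(x in B) (r * \1_(phi @^-1` (g @^-1` [set r])) x * Y x)%:E)%E.
  rewrite -ge0_integral_fsum//; last 2 first.
  - move=> r; apply/measurable_EFinP/measurable_funM.
      apply: measurable_funM => //; apply: measurable_indic; exact: mpre.
    exact: measurable_funTS.
  - move=> r x _; rewrite EFinM mule_ge0 ?lee_fin//.
    exact: (nnfun_muleindic_ge0 g r (phi x)).
  apply: eq_integral => x _; rewrite fsumEFin// fimfunE.
  by rewrite mulrC mulr_fsumr//; congr EFin; apply: eq_fsbigr => r _; rewrite
    mulrC.
transitivity (\sum_(r \in range g) \int[nu]_y (r * \1_(g @^-1` [set r])
  y)%:E)%E.
  apply: eq_fsbigr => r /set_mem [y _ yr].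
  rewrite integralZl_indic_nnsfun// integral_indic// setIT -nuE//.
  rewrite integral_mkcondr -ge0_integralZl_EFin//.
  - apply: eq_integral => x _; rewrite patchE indicE.
    by case: ifP => _; rewrite -EFinM ?mulr1 ?mulr0 ?mul0r.
  - by move=> x _; rewrite patchE; case: ifP => // _; rewrite lee_fin.
  - apply: (measurable_restrict (fun x => (Y x)%:E) (mpre (mg r)) mB).1.
    by apply/measurable_EFinP; exact: measurable_funTS.
  - by rewrite -yr.
rewrite -ge0_integral_fsum//.
- by apply: eq_integral => x _; rewrite fsumEFin// -fimfunE.
- by move=> r; exact/measurable_EFinP/measurable_funM.
- by move=> r x _; rewrite nnfun_muleindic_ge0.
Qed.

(** Change of variables: if nu is the image under phi of the measure with
    density Y on B, integrals against nu can be computed upstairs. It serves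
    both for the normal density and, in the independence argument, for the other
    factors of a product in the role of Y. *)
Lemma ge0_integral_density (f : T2 -> R) :
  measurable_fun setT f -> (forall y, 0 <= f y) ->
  (\int[mu]_(x in B) (f (phi x) * Y x)%:E = \int[nu]_y (f y)%:E)%E.
Proof.
move=> mf f0.
have mfE : measurable_fun setT (EFin \o f) by exact/measurable_EFinP.
pose g := nnsfun_approx measurableT mfE.
have gf y : (EFin \o (fun n => g n y)) @ \oo --> (f y)%:E.
  by apply: cvg_nnsfun_approx => // z _; rewrite lee_fin.
have ndg y : {homo (fun n => g n y) : n m / (n <= m)%N >-> n <= m}.
  by move=> n m nm; exact/lefP/nd_nnsfun_approx.
transitivity (limn (fun n => \int[mu]_(x in B) (g n (phi x) * Y x)%:E)%E).
  rewrite -monotone_convergence//.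
  - apply: eq_integral => x _; apply/esym/cvg_lim => //.
    have -> : (fun n => (g n (phi x) * Y x)%:E) = (fun n => (g n (phi x))%:E *
      (Y x)%:E)%E.
      by apply/funext => n; rewrite EFinM.
    by rewrite EFinM; apply: cvgeZr => //; exact: gf.
  - move=> n; apply/measurable_EFinP/measurable_funM; last exact:
    measurable_funTS.
    by apply: measurable_funTS; apply: measurableT_comp.
  - by move=> n x _; rewrite lee_fin mulr_ge0.
  - by move=> x _ n m nm; rewrite lee_fin ler_wpM2r// ndg.
under [X in limn X]eq_fun do rewrite density_nnsfun.
rewrite -monotone_convergence//.
- by apply: eq_integral => x _; apply/cvg_lim => //; exact: gf.
- by move=> n; exact/measurable_EFinP.
- by move=> n x _; rewrite lee_fin.
- by move=> x _ n m nm; rewrite lee_fin ndg.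
Qed.

End Density.

Section Independence.
Context {disp : measure_display} {Omega : measurableType disp} {R : realType}.
Variable P : probability Omega R.

Lemma measurable_RV_preimage (X : {RV P >-> R}) A :
  measurable A -> measurable (X @^-1` A).
Proof. by move=> mA; rewrite -[_ @^-1` _]setTI; exact: measurable_funP. Qed.

Context {I : finType} {X : I -> {RV P >-> R}}.
Hypothesis indep : mutually_independent X.

Let cylinder (J : {set I}) (A : I -> set R) : set Omega :=
  \bigcap_(i in [set` J]) (X i @^-1` A i).

Let cylinder_setU1 k (J : {set I}) A B : k \notin J ->
  cylinder (k |: J)%SET (fun i => if i == k then B else A i) =
  cylinder J A `&` X k @^-1` B.
Proof.
move=> kJ; rewrite setIC; apply/seteqP; split=> w /=.
  move=> h; split; first by have := h k; rewrite /= setU11 eqxx; apply.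
  move=> i /= iJ; have := h i; rewrite /= in_setU1 iJ orbT.
  by rewrite ifN; [apply|apply: contraNneq kJ => <-].
move=> [wB h] i /=; rewrite in_setU1; case: eqVneq => [-> _//|_ /= iJ].
exact: h.
Qed.

Let probability_cylinder_setU1 k (J : {set I}) A B : k \notin J ->
  (forall i, measurable (A i)) -> measurable B ->
  (P (cylinder J A `&` X k @^-1` B) = P (cylinder J A) * P (X k @^-1` B))%E.
Proof.
move=> kJ mA mB; rewrite -cylinder_setU1// /cylinder !indep// => [|i].
  rewrite big_setU1//= eqxx muleC; congr (_ * _)%E; apply: eq_bigr => i iJ.
  by rewrite ifN//; apply: contraNneq kJ => <-.
by case: ifP.
Qed.

(** Independence of events is upgraded to integrals one variable at a time. The
    induction hypothesis must carry an event on the remaining variables: applied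
    to the events X_k in B it says that the measure B |-> E [Y ; X_k in B], for
    Y the product of the later factors, is a multiple of the law of X_k. *)
Lemma integral_prod_indep (f : I -> R -> R) (M : I -> R) :
  (forall i, measurable_fun setT (f i)) -> (forall i x, 0 <= f i x) ->
  (forall i, (\int[P]_w (f i (X i w))%:E = (M i)%:E)%E) ->
  (\int[P]_w (\prod_i f i (X i w))%:E = (\prod_i M i)%:E)%E.
Proof.
move=> mf f0 fM.
have M0 i : 0 <= M i.
  by rewrite -lee_fin -fM; apply: integral_ge0 => w _; rewrite lee_fin.
suff H (s : seq I) : uniq s -> forall (J : {set I}) A, (forall i, measurable (A
  i)) ->
    {in s, forall i, i \notin J} ->
    (\int[P]_(w in cylinder J A) (\prod_(i <- s) f i (X i w))%:E =
       (\prod_(i <- s) M i)%:E * P (cylinder J A))%E.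
  have cylT : cylinder finset.set0 (fun=> setT) = setT.
    by apply/seteqP; split=> // w _ i /=; rewrite inE.
  have := H (index_enum I) (index_enum_uniq I) finset.set0 (fun=> setT).
  by rewrite cylT probability_setT mule1; apply=> // i; rewrite inE.
elim: s => [_ J A mA _|k s IH /andP[ks us] J A mA sJ].
  under eq_integral do rewrite big_nil.
  rewrite big_nil integral_cst//.
  by apply: fin_bigcap_measurable => // i _; exact: measurable_RV_preimage.
have kJ : k \notin J by rewrite sJ// mem_head.
have sJ' : {in s, forall i, i \notin (k |: J)%SET}.
  move=> i si; rewrite in_setU1 negb_or sJ ?inE ?si ?orbT// andbT.
  by apply: contraNneq ks => <-.
have mJ : measurable (cylinder J A).
  by apply: fin_bigcap_measurable => // i _; exact: measurable_RV_preimage.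
have c0 : 0 <= (\prod_(i <- s) M i) * fine (P (cylinder J A)).
  by rewrite mulr_ge0 ?prodr_ge0// fine_ge0.
under eq_integral do rewrite big_cons.
rewrite (ge0_integral_density (nu := mscale (NngNum c0) (distribution P (X k)))
  (phi := X k)) //.
- rewrite ge0_integral_mscale//=; last 2 first.
  + exact/measurable_EFinP.
  + by move=> x _; rewrite lee_fin.
  rewrite ge0_integral_distribution/=; last 2 first.
  + exact/measurable_EFinP.
  + by move=> x; rewrite lee_fin.
  rewrite fM big_cons !EFinM fineK ?fin_num_measure//.
  by rewrite muleC muleA.
- by apply: measurable_prod => i _; apply: measurableT_comp.
- by move=> x; rewrite prodr_ge0.
- move=> B mB; rewrite -cylinder_setU1// IH//; last by move=> i; case: ifP.
  rewrite cylinder_setU1// probability_cylinder_setU1//.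
  transitivity (((\prod_(i <- s) M i) * fine (P (cylinder J A)))%:E
      * P (X k @^-1` B))%E; last by [].
  by rewrite muleA EFinM fineK// fin_num_measure.
Qed.

End Independence.

Section GaussianTail.
Context {disp : measure_display} {Omega : measurableType disp} {R : realType}.
Variable P : probability Omega R.

Lemma measurable_expRM (a : R) : measurable_fun setT (fun x : R => expR (a *
  x)).
Proof.
apply: measurableT_comp; first exact: measurable_expR.
by apply: measurable_funM.
Qed.

(** Completing the square. *)
Lemma expRM_normal_pdf (s a x : R) : s != 0 ->
  expR (a * x) * normal_pdf 0 s x =
  expR (a ^+ 2 * s ^+ 2 / 2) * normal_pdf (a * s ^+ 2) s x.
Proof.
move=> s0; rewrite !normal_pdfE// /normal_fun !(mulrCA (expR _)) -!expRD.
by congr (_ * expR _); rewrite subr0; field.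
Qed.

Lemma gaussian_mgf (s a : R) (X : {RV P >-> R}) : s != 0 -> gaussian 0 s X ->
  (\int[P]_w (expR (a * X w))%:E = (expR (a ^+ 2 * s ^+ 2 / 2))%:E)%E.
Proof.
move=> s0 gX.
rewrite -(@ge0_integral_distribution _ _ _ _ _ P X (fun x => (expR (a *
  x))%:E)); last 2 first.
- apply/measurable_EFinP; exact: measurable_expRM.
- by move=> x; rewrite lee_fin expR_ge0.
rewrite -(@ge0_integral_density _ _ _ _ _ (@lebesgue_measure R)
   (distribution P X) id (normal_pdf 0 s) setT)//.
- under eq_integral do rewrite expRM_normal_pdf// EFinM.
  rewrite ge0_integralZl_EFin//.
  + by rewrite integral_normal_pdf mule1.
  + by move=> x _; rewrite lee_fin normal_pdf_ge0.
  + by apply/measurable_EFinP; exact: measurable_normal_pdf.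
- exact: measurable_normal_pdf.
- by move=> x; exact: normal_pdf_ge0.
- by move=> A mA; rewrite setTI; apply/esym; exact: gX.
- exact: measurable_expRM.
Qed.

Context {I : finType} {X : I -> {RV P >-> R}} (s : R).
Hypotheses (s0 : 0 < s) (indep : mutually_independent X).
Hypothesis gX : forall i, gaussian 0 s (X i).

Let lin (c : I -> R) w := \sum_i c i * X i w.

Lemma measurable_lin (c : I -> R) : measurable_fun setT (lin c).
Proof. by apply: measurable_sum => i; apply: measurable_funM. Qed.

Lemma gaussian_lin_mgf (c : I -> R) (a : R) :
  (\int[P]_w (expR (a * lin c w))%:E =
     (expR (a ^+ 2 * s ^+ 2 / 2 * \sum_i c i ^+ 2))%:E)%E.
Proof.
have := @integral_prod_indep _ _ _ P _ _ indep (fun i x => expR (a * c i * x))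
  (fun i => expR ((a * c i) ^+ 2 * s ^+ 2 / 2)).
rewrite -expR_sum mulr_sumr => H.
rewrite [in RHS](eq_bigr (fun i => (a * c i) ^+ 2 * s ^+ 2 / 2)); last first.
  by move=> i _; ring.
rewrite -H.
- apply: eq_integral => w _; rewrite -expR_sum /lin mulr_sumr.
  by congr (expR _)%:E; apply: eq_bigr => i _; rewrite mulrA.
- by move=> i; exact: measurable_expRM.
- by move=> i x; exact: expR_ge0.
- by move=> i; apply: gaussian_mgf => //; rewrite gt_eqF.
Qed.

(** Chernoff's method; la is the minimiser of la^2 s^2 V / 2 - la t. *)
Lemma gaussian_lin_upper_tail (c : I -> R) (V t : R) :
  0 < V -> \sum_i c i ^+ 2 <= V -> 0 <= t ->
  (P [set w | (t <= lin c w)%R] <= (expR (- (t ^+ 2 / (2 * s ^+ 2 * V))))%:E)%E.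
Proof.
move=> V0 cV t0; pose la := t / (s ^+ 2 * V).
have la0 : 0 <= la by rewrite divr_ge0// mulr_ge0 ?sqr_ge0// ltW.
set E := [set w | _].
have mE : measurable E.
  have -> : E = lin c @^-1` `[t, +oo[.
    by apply/seteqP; split=> w /=; rewrite in_itv/= andbT.
  by rewrite -[_ @^-1` _]setTI; apply: measurable_lin.
have me : measurable_fun setT (fun w => (expR (la * lin c w))%:E).
  apply/measurable_EFinP; apply: (measurableT_comp (measurable_expRM la)).
  exact: measurable_lin.
have h1 : ((expR (la * t))%:E * P E <= (expR (la ^+ 2 * s ^+ 2 / 2 * V))%:E)%E.
  rewrite -integral_cst//.
  apply: (@le_trans _ _ (\int[P]_w (expR (la * lin c w))%:E)%E); last first.
    by rewrite gaussian_lin_mgf lee_fin ler_expR ler_wpM2l// divr_ge0//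
      mulr_ge0// sqr_ge0.
  apply: (@le_trans _ _ (\int[P]_(w in E) (expR (la * lin c w))%:E)%E).
    apply: ge0_le_integral => //.
    - by move=> w _; rewrite lee_fin expR_ge0.
    - exact: measurable_funTS.
    - by move=> w Ew; rewrite lee_fin ler_expR ler_wpM2l.
  apply: ge0_subset_integral => //.
have -> : - (t ^+ 2 / (2 * s ^+ 2 * V)) = la ^+ 2 * s ^+ 2 / 2 * V - la * t.
  by rewrite /la; field; rewrite !gt_eqF.
have PE : P E = (fine (P E))%:E by rewrite fineK// fin_num_measure.
rewrite PE -EFinM lee_fin in h1; rewrite PE lee_fin.
by rewrite expRB ler_pdivlMr ?expR_gt0// mulrC.
Qed.

Lemma gaussian_lin_tail (c : I -> R) (V t : R) :
  0 < V -> \sum_i c i ^+ 2 <= V -> 0 <= t ->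
  (P [set w | (t <= `|lin c w|)%R] <= (2 * expR (- (t ^+ 2 / (2 * s ^+ 2 *
    V))))%:E)%E.
Proof.
move=> V0 cV t0.
have mE c' : measurable [set w | t <= lin c' w].
  have -> : [set w | t <= lin c' w] = lin c' @^-1` `[t, +oo[.
    by apply/seteqP; split=> w /=; rewrite in_itv/= andbT.
  by rewrite -[_ @^-1` _]setTI; apply: measurable_lin.
have -> : [set w | t <= `|lin c w|] =
    [set w | t <= lin c w] `|` [set w | t <= lin (fun i => - c i) w].
  have linN w : lin (fun i => - c i) w = - lin c w.
    by rewrite /lin -sumrN; apply: eq_bigr => i _; rewrite mulNr.
  apply/seteqP; split=> w /=; rewrite linN ler_normr; first by move/orP.
  by move=> h; apply/orP.
apply: (le_trans (measureU2 _ (mE _) (mE _))).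
rewrite mulr_natl mulr2n EFinD; apply: leeD; apply: gaussian_lin_upper_tail =>
  //.
by under eq_bigr do rewrite sqrrN.
Qed.

End GaussianTail.

(** * Uniform bounds for Gaussian quadratic forms *)

Section MatrixTail.
Context {disp : measure_display} {Omega : measurableType disp} {R : realType}.
Variable P : probability Omega R.
Variables (N : nat) (s : R) (W : 'I_N -> 'I_N -> {RV P >-> R}).
Hypotheses (s0 : 0 < s) (hW : symmetric_gaussian s W).

(** The coefficient of the independent entry (p.1, p.2) in a linear form of W:
    an off-diagonal entry occurs twice in W. *)
Let fold_coef (A : 'M[R]_N) (p : 'I_N * 'I_N) : R :=
  A p.1 p.2 + (if (p.1 < p.2)%N then A p.2 p.1 else 0).

Lemma sum_upper_index (F : 'I_N * 'I_N -> R) :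
  \sum_(k : upper_index N) F (val k) = \sum_(p : 'I_N * 'I_N | (p.1 <= p.2)%N)
    F p.
Proof. by rewrite -(@big_sub _ _ _ _ [pred p : 'I_N * 'I_N | (p.1 <= p.2)%N]).
  Qed.

Lemma sum_fold_upper (F : 'I_N -> 'I_N -> R) :
  \sum_i \sum_j F i j =
  \sum_(p : 'I_N * 'I_N | (p.1 <= p.2)%N)
     (F p.1 p.2 + (if (p.1 < p.2)%N then F p.2 p.1 else 0)).
Proof.
rewrite pair_big/= (bigID (fun p : 'I_N * 'I_N => (p.1 <= p.2)%N))/=.
rewrite big_split/=; congr (_ + _).
rewrite -big_mkcondr/=.
rewrite (reindex_inj (h := fun p : 'I_N * 'I_N => (p.2, p.1)))/=; last first.
  by move=> [a b] [c e] [-> ->].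
apply: eq_bigl => p; rewrite -ltnNge.
by case: ltngtP.
Qed.

Lemma mxdot_random_mx (A : 'M[R]_N) w :
  mxdot A (random_mx W w) =
  \sum_(k : upper_index N) fold_coef A (val k) * W (val k).1 (val k).2 w.
Proof.
have [Wsym _ _] := hW.
rewrite (sum_upper_index (fun p : 'I_N * 'I_N => fold_coef A p * W p.1 p.2 w)).
rewrite mxdotE exchange_big/=.
under eq_bigr do under eq_bigr do rewrite mxE.
rewrite (sum_fold_upper (fun i j => A i j * W i j w)).
apply: eq_bigr => p _; rewrite /fold_coef mulrDl; congr (_ + _).
by case: ifP => _; rewrite ?mul0r// Wsym.
Qed.

Lemma fold_coef_sqr_le (A : 'M[R]_N) :
  \sum_(k : upper_index N) fold_coef A (val k) ^+ 2 <= 2 * mxdot A A.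
Proof.
rewrite (sum_upper_index (fun p : 'I_N * 'I_N => fold_coef A p ^+ 2)) mxdotE
  exchange_big/=.
rewrite (sum_fold_upper (fun i j => A i j * A i j)) mulr_sumr.
apply: ler_sum => p _; rewrite /fold_coef; case: ifP => _.
  by have := sqr_ge0 (A p.1 p.2 - A p.2 p.1); lra.
by have := sqr_ge0 (A p.1 p.2); lra.
Qed.

Lemma measurable_mxdot_random (A : 'M[R]_N) (t : R) :
  measurable [set w | t <= `|mxdot A (random_mx W w)|].
Proof.
have -> : [set w | t <= `|mxdot A (random_mx W w)|] =
  (fun w => `|\sum_(k : upper_index N) fold_coef A (val k) * W (val k).1 (val
    k).2 w|)
    @^-1` `[t, +oo[.
  by apply/seteqP; split=> w /=; rewrite in_itv/= andbT mxdot_random_mx.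
rewrite -[_ @^-1` _]setTI.
have H : measurable_fun setT (fun w => \sum_(k : upper_index N)
    fold_coef A (val k) * W (val k).1 (val k).2 w).
  exact: (measurable_lin (X := fun k : upper_index N => W (val k).1 (val k).2)).
by apply: (measurableT_comp _ H).
Qed.

Lemma mxdot_random_tail (A : 'M[R]_N) (a t : R) :
  0 < a -> mxdot A A <= a -> 0 <= t ->
  (P [set w | (t <= `|mxdot A (random_mx W w)|)%R]
     <= (2 * expR (- (t ^+ 2 / (4 * s ^+ 2 * a))))%:E)%E.
Proof.
move=> a0 Aa t0; have [_ gW iW] := hW.
under eq_set do rewrite mxdot_random_mx.
have -> : 4 * s ^+ 2 * a = 2 * s ^+ 2 * (2 * a) by ring.
apply: (gaussian_lin_tail (X := fun k : upper_index N => W (val k).1 (val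
  k).2)) => //.
- by move=> k; apply: gW; exact: (valP k).
- by rewrite mulr_gt0.
- by rewrite (le_trans (fold_coef_sqr_le A))// ler_pM2l.
Qed.

Lemma probability_bigsetU_le (T : Type) (r : seq T) (p : pred T) (F : T -> set
  Omega) :
  (forall k, measurable (F k)) ->
  measurable (\big[setU/set0]_(k <- r | p k) F k) /\
  (P (\big[setU/set0]_(k <- r | p k) F k) <= \sum_(k <- r | p k) P (F k))%E.
Proof.
move=> mF; have mU : measurable (\big[setU/set0]_(k <- r | p k) F k).
  by apply: bigsetU_measurable.
split=> //; elim: r {mU} => [|k r IH]; first by rewrite !big_nil measure0.
rewrite !big_cons; case: ifP => // _.
apply: (le_trans (measureU2 _ (mF k) _)); first exact: bigsetU_measurable.
exact: leeD.
Qed.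

(** Each value of the form of M is a linear form of W, with coefficient matrix
    of norm at most sqrt v |x|^2, so the tail at a level proportional to |x|^2
    is the same at all points of the net and the union bound multiplies it by
    their number. The factor 49 comes from the 7/8 of the net. *)
Lemma quad_bounded_whp n (M : Omega -> 'M[R]_n) (A : 'cV[R]_n -> 'M[R]_N) (v t
  : R) :
  (0 < n)%N -> 0 < v -> 0 <= t ->
  (forall w, (M w)^T = M w) ->
  (forall x w, mxdot x (M w *m x) = mxdot (A x) (random_mx W w)) ->
  (forall x, mxdot (A x) (A x) <= v * mxdot x x ^+ 2) ->
  exists B, [/\ measurable B,
    (P B <= (2 * expR (9 / 2 * n%:R - 49 * t ^+ 2 / (256 * s ^+ 2 * v)))%:E)%E &
    forall w, ~ B w -> quad_bounded t (M w)].
Proof.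
move=> n0 v0 t0 Msym MA Av.
pose bad (k : grid_index n) : set Omega :=
  [set w | 7 / 8 * t * mxdot (grid_point k) (grid_point k)
      <= `|mxdot (A (grid_point k)) (random_mx W w)| ].
have mbad k : measurable (bad k) by exact: measurable_mxdot_random.
exists (\big[setU/set0]_(k in shell (R:=R) n) bad k).
have [mU PU] := probability_bigsetU_le (index_enum _) (mem (shell (R:=R) n))
  mbad.
split=> //.
  apply: (le_trans PU).
  apply: (@le_trans _ _ (\sum_(k in shell (R:=R) n)
     (2 * expR (- (49 * t ^+ 2 / (256 * s ^+ 2 * v))))%:E)%E).
    apply: lee_sum => k kS; have : k \in shell (R:=R) n by [].
    rewrite inE => /andP[z4 _].
    have z0 : 0 < mxdot (grid_point (R:=R) k) (grid_point k).
      by rewrite (lt_le_trans _ z4)// mulr_gt0// ltr0n.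
    apply: (le_trans (mxdot_random_tail (a := v * mxdot (grid_point k)
      (grid_point k) ^+ 2) _ _ _)).
    - by rewrite mulr_gt0// exprn_gt0.
    - exact: Av.
    - by rewrite !mulr_ge0// ltW.
    rewrite lee_fin le_eqVlt; apply/orP; left; apply/eqP; congr (_ * expR (-
      _)).
    by field; rewrite !gt_eqF.
  rewrite sumEFin lee_fin sumr_const -[leLHS]mulr_natl mulrCA ler_wpM2l//.
  rewrite expRD ler_wpM2r ?expR_ge0// [9 / 2 * _]mulrC expRM_natl.
  exact: card_shell.
move=> w nbad; apply: quad_bounded_of_shell => // k kS.
rewrite MA leNgt; apply/negP => h; apply: nbad.
rewrite (bigD1 k)//=; left; rewrite /bad/=; exact: ltW.
Qed.

End MatrixTail.

(** * Numerical constants *)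

Section Numerics.
Context {R : realType}.

Lemma sigma_sqr_le (mu rr D sg : R) : 0 < mu -> 0 < rr -> 0 < D -> 0 < sg ->
  sg <= mu `^ (1 / 4) / (31 * Num.sqrt (rr * (D / mu))) ->
  961 * (sg ^+ 2 * rr * D) <= mu * Num.sqrt mu.
Proof.
move=> mu0 r0 D0 sg0 h.
have q0 : 0 < rr * (D / mu) by rewrite mulr_gt0// divr_gt0.
have s0 : 0 < Num.sqrt (rr * (D / mu)) by rewrite sqrtr_gt0.
have p4 : (mu `^ (1 / 4)) ^+ 2 = Num.sqrt mu.
  rewrite -powR_mulrn ?powR_ge0// -powRrM -powR12_sqrt ?(ltW mu0)//.
  by congr (_ `^ _); field.
have : sg ^+ 2 <= (mu `^ (1 / 4) / (31 * Num.sqrt (rr * (D / mu)))) ^+ 2.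
  by rewrite ler_sqr ?nnegrE ?(ltW sg0)// divr_ge0 ?powR_ge0 ?mulr_ge0// ltW.
rewrite expr_div_n p4 exprMn sqr_sqrtr ?(ltW q0)//.
rewrite ler_pdivlMr ?mulr_gt0 ?exprn_gt0 ?invr_gt0//.
have muV : 0 < mu^-1 by rewrite invr_gt0.
move=> h2; rewrite -(ler_pM2r muV).
have -> : mu * Num.sqrt mu / mu = Num.sqrt mu by field; rewrite gt_eqF.
apply: le_trans h2; rewrite le_eqVlt; apply/orP; left; apply/eqP.
by field; rewrite gt_eqF.
Qed.

Lemma noise_bounds (mu rr D sg : R) (w := 5 * sg * Num.sqrt D) :
  2 <= mu -> 1 <= rr -> 0 <= D -> 0 <= sg ->
  961 * (sg ^+ 2 * rr * D) <= mu * Num.sqrt mu ->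
  7 * w <= mu /\ 38 * (w ^+ 2 * rr) <= mu * Num.sqrt mu.
Proof.
move=> mu2 r1 D0 sg0 h.
have mu0 : 0 <= mu by lra.
have w2 : w ^+ 2 = 25 * sg ^+ 2 * D.
  by rewrite /w exprMn sqr_sqrtr// exprMn; ring.
have X0 : 0 <= sg ^+ 2 * D by rewrite mulr_ge0// sqr_ge0.
split; last first.
  apply: le_trans h; rewrite w2.
  have : 0 <= sg ^+ 2 * D * rr by rewrite mulr_ge0//; lra.
  by lra.
have sm : Num.sqrt mu <= 5 / 7 * mu.
  rewrite -ler_sqr ?nnegrE ?sqrtr_ge0//; last by lra.
  rewrite sqr_sqrtr// exprMn; nra.
have : sg ^+ 2 * D <= sg ^+ 2 * rr * D.
  have -> : sg ^+ 2 * rr * D = sg ^+ 2 * D * rr by ring.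
  by rewrite ler_peMr.
have : mu * Num.sqrt mu <= mu * (5 / 7 * mu) by rewrite ler_wpM2l.
move=> h1 h2.
have w0 : 0 <= w by rewrite /w !mulr_ge0// sqrtr_ge0.
rewrite -ler_sqr ?nnegrE ?mulr_ge0//.
rewrite exprMn w2; have := sqr_ge0 mu; rewrite expr2.
by lra.
Qed.

(** 1225/256 exceeds 9/2 by more than 1/4, and 3 - 2 sqrt 2 lies in [0, 1]. *)
Lemma global_tail (D sg : R) : 0 < D -> 0 < sg ->
  expR (9 / 2 * D - 49 * (5 * sg * Num.sqrt D) ^+ 2 / (256 * sg ^+ 2 * 1))
  <= expR (- ((3 - 2 * Num.sqrt 2) ^+ 2 / 4 * D)).
Proof.
move=> D0 sg0; rewrite ler_expR exprMn sqr_sqrtr ?(ltW D0)//.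
have -> : 49 * ((5 * sg) ^+ 2 * D) / (256 * sg ^+ 2 * 1) = 1225 / 256 * D.
  by field; rewrite gt_eqF.
have s2 : Num.sqrt 2 ^+ 2 = 2 :> R by rewrite sqr_sqrtr.
have s0 : 0 <= Num.sqrt 2 :> R by exact: sqrtr_ge0.
have : (3 - 2 * Num.sqrt 2) ^+ 2 <= 1 :> R.
  by move: (Num.sqrt 2) s2 s0 => x; nra.
move: ((_ - _) ^+ 2) => x x1.
have : x * D <= 1 * D by rewrite ler_pM2r.
by lra.
Qed.

(** As r <= D / m, the ratio m / sigma^2 is at least 961 r^2 sqrt m. The tail
    exponent 49/1024 m / sigma^2 then beats the entropy 9 r of the net by 36
    sqrt m, and exp (36 s) >= (9 s)^4 dominates 2 s^4 = 2 m^2. *)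
Lemma block_tail (mu rr D sg : R) : 1 <= mu -> 1 <= rr -> mu * rr <= D -> 0 <
  sg ->
  961 * (sg ^+ 2 * rr * D) <= mu * Num.sqrt mu ->
  2 * expR (9 / 2 * (rr + rr) - 49 * (mu / 2) ^+ 2 / (256 * sg ^+ 2 * mu)) <=
  1 / mu / mu.
Proof.
move=> mu1 r1 rD sg0 h.
have mu0 : 0 < mu by lra.
pose q := Num.sqrt mu.
have q1 : 1 <= q by rewrite -(@ler_sqr _ 1) ?nnegrE ?sqrtr_ge0// expr1n
  sqr_sqrtr// ltW.
have q2 : q ^+ 2 = mu by rewrite sqr_sqrtr// ltW.
have q0 : 0 < q by lra.
have rr2 : 1 <= rr * rr by rewrite -[1]mulr1; apply: ler_pM.
have s2 : 0 < sg ^+ 2 by rewrite exprn_gt0.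
have snr : 961 * (rr * rr * q) <= mu / sg ^+ 2.
  rewrite ler_pdivlMr// -(@ler_pM2l _ q)//.
  rewrite -[in leRHS]/(Num.sqrt mu) [leRHS]mulrC; apply: le_trans h.
  have -> : q * (961 * (rr * rr * q) * sg ^+ 2) =
    961 * (sg ^+ 2 * rr * (mu * rr)) by rewrite -q2; ring.
  have : sg ^+ 2 * rr * (mu * rr) <= sg ^+ 2 * rr * D.
    by apply: ler_wpM2l => //; rewrite mulr_ge0 ?ltW//; lra.
  by lra.
have e1 : 9 / 2 * (rr + rr) - 49 * (mu / 2) ^+ 2 / (256 * sg ^+ 2 * mu) <= -
  (36 * q).
  have -> : 49 * (mu / 2) ^+ 2 / (256 * sg ^+ 2 * mu) = 49 / 1024 * (mu / sg ^+
    2).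
    by field; rewrite !gt_eqF.
  have : rr <= rr * rr * q.
    rewrite -mulrA ler_peMr//; first by lra.
    by rewrite -[1]mulr1; apply: ler_pM.
  have : q <= rr * rr * q by rewrite ler_peMl// ltW.
  by lra.
apply: (@le_trans _ _ (2 * expR (- (36 * q)))); first by rewrite ler_pM2l//
  ler_expR.
rewrite expRN -q2 -[1 / q ^+ 2 / q ^+ 2]mulr1.
rewrite ler_pdivrMr ?expR_gt0//.
have -> : 36 * q = 4%:R * (9 * q) by ring.
rewrite expRM_natl.
have : (9 * q) ^+ 4 <= expR (9 * q) ^+ 4.
  apply: lerXn2r; rewrite ?nnegrE ?expR_ge0//; first by lra.
  by apply: le_trans (expR_ge1Dx _); lra.
move: (expR (9 * q) ^+ 4) => X hX.
have q4 : 0 < q ^+ 4 by rewrite exprn_gt0.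
have -> : 1 / q ^+ 2 / q ^+ 2 * 1 * X = X / q ^+ 4 by field; rewrite gt_eqF.
rewrite ler_pdivlMr// (le_trans _ hX)// exprMn.
by rewrite ler_pM2r//; lra.
Qed.

End Numerics.

(** * The two noise estimates and the theorem *)

Section Dilation.
Context {R : realType} {r : nat}.

(** The operator norm of a square matrix G is the norm of the quadratic form of
    this symmetric matrix, so the net for quadratic forms also serves for G. *)
Definition dilation (G : 'M[R]_r) : 'M[R]_(r + r) := block_mx 0 G G^T 0.

Lemma dilation_sym G : (dilation G)^T = dilation G.
Proof. by rewrite /dilation tr_block_mx !trmx0 trmxK. Qed.

Lemma mxdot_col_mx n1 n2 p (a c : 'M[R]_(n1, p)) (b e : 'M[R]_(n2, p)) :
  mxdot (col_mx a b) (col_mx c e) = mxdot a c + mxdot b e.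
Proof. by rewrite /mxdot tr_col_mx mul_row_col mxtraceD. Qed.

Lemma mxdot_dilation G (x : 'cV[R]_(r + r)) :
  mxdot x (dilation G *m x) = 2 * mxdot (usubmx x) (G *m dsubmx x).
Proof.
rewrite -{1 2}(vsubmxK x) /dilation mul_block_col !mul0mx add0r addr0
  mxdot_col_mx.
by rewrite -mxdot_mull (mxdotC (G *m _)) mulr_natl mulr2n.
Qed.

Lemma fro_of_dilation G (t : R) (v : 'cV[R]_r) : 0 <= t ->
  quad_bounded t (dilation G) -> fro (G *m v) <= t * fro v.
Proof.
move=> t0 bG; have := quad_bounded_mul (col_mx 0 v) t0 (dilation_sym G) bG.
rewrite /dilation mul_block_col mulmx0 add0r mulmx0 mul0mx addr0.
by rewrite /fro !mxdot_col_mx !mxdot0 add0r addr0.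
Qed.

End Dilation.

Section GoodEvents.
Context {disp : measure_display} {Omega : measurableType disp} {R : realType}.
Variables (P : probability Omega R) (m r : nat) (d : 'I_m -> nat).
Variables (Theta : forall i, 'M[R]_(d i, r)) (sigma : R).
Variable W : 'I_(total_dim d) -> 'I_(total_dim d) -> {RV P >-> R}.
Hypotheses (hTheta : forall i, stiefel (Theta i)) (s0 : 0 < sigma).
Hypothesis (hW : symmetric_gaussian sigma W).

Lemma random_mx_sym w : (random_mx W w)^T = random_mx W w.
Proof. by case: hW => Wsym _ _; apply/matrixP => i j; rewrite !mxE Wsym. Qed.

Lemma mxdot_outer n (a b : 'cV[R]_n) (M : 'M[R]_n) :
  mxdot a (M *m b) = mxdot (a *m b^T) M.
Proof. by rewrite /mxdot trmx_mul trmxK mxtrace_mulC [RHS]mxtrace_mulC !mulmxA.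
  Qed.

Lemma mxdot_outer_sqr n (a b : 'cV[R]_n) :
  mxdot (a *m b^T) (a *m b^T) = mxdot a a * mxdot b b.
Proof.
have E (c : 'cV[R]_n) : c^T *m c = (mxdot c c)%:M.
  by rewrite [LHS]mx11_scalar /mxdot /mxtrace big_ord1.
rewrite mxdot_mull mulmxA E mul_scalar_mx mxdotZr mxdot_tr.
by [].
Qed.

Lemma spectral_norm_whp (t : R) : (0 < total_dim d)%N -> 0 <= t ->
  exists B, [/\ measurable B,
    (P B <= (2 * expR (9 / 2 * (total_dim d)%:R -
       49 * t ^+ 2 / (256 * sigma ^+ 2 * 1)))%:E)%E &
    forall w, ~ B w -> quad_bounded t (random_mx W w)].
Proof.
move=> D0 t0.
apply: (quad_bounded_whp s0 hW (A := fun x => x *m x^T)) => //.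
- exact: random_mx_sym.
- by move=> x w; rewrite mxdot_outer.
- by move=> x; rewrite mxdot_outer_sqr mul1r expr2.
Qed.

(** For G = Theta_i^T (W Theta)_i, the form of the dilation of G at (a, b) is 2
    (E a)^T W (Theta b) with E the embedded block. Its coefficient matrix has
    squared norm 4 m |a|^2 |b|^2 <= m (|a|^2 + |b|^2)^2, in which d_i does not
    appear. *)
Lemma block_noise_whp (i : 'I_m) (t : R) : (0 < m)%N -> (0 < r)%N -> 0 <= t ->
  exists B, [/\ measurable B,
    (P B <= (2 * expR (9 / 2 * (r%:R + r%:R) -
       49 * t ^+ 2 / (256 * sigma ^+ 2 * m%:R)))%:E)%E &
    forall w, ~ B w -> forall v : 'cV[R]_r,
     fro ((block_embed Theta i)^T *m (random_mx W w *m (\mxcol_i Theta i *m v)))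
       <= t * fro v].
Proof.
move=> m0 r0 t0; set E := block_embed Theta i; set T := \mxcol_i Theta i.
have TT : T^T *m T = m%:R%:M by exact: feasible_gram.
have EE : E^T *m E = 1%:M.
  by rewrite block_embed_mul mxcolK eqxx scale1r hTheta.
have mR : 0 < m%:R :> R by rewrite ltr0n.
have [] := @quad_bounded_whp _ _ _ _ _ _ _ s0 hW (r + r)%N
  (fun w => dilation (E^T *m random_mx W w *m T))
  (fun x => 2 *: ((E *m usubmx x) *m (T *m dsubmx x)^T)) m%:R t.
- by rewrite addn_gt0 r0.
- by [].
- by [].
- by move=> w; exact: dilation_sym.
- move=> x w; rewrite mxdot_dilation mxdotZl -mxdot_outer -!mulmxA.
  by rewrite [in RHS]mxdot_mull.
- move=> x; rewrite mxdotZl mxdotZr mxdot_outer_sqr.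
  rewrite (mxdot_mull E) (mxdot_mull T) !mulmxA EE TT mul1mx mul_scalar_mx
    mxdotZr.
  rewrite -{5 6}(vsubmxK x) mxdot_col_mx.
  move: (mxdot (usubmx x) _) (mxdot (dsubmx x) _) => a b.
  have -> : 2 * (2 * (a * (m%:R * b))) = m%:R * (4 * a * b) by ring.
  rewrite ler_pM2l//; have := sqr_ge0 (a - b); lra.
move=> B [mB PB hB]; exists B; split => //.
  by rewrite natrD in PB.
move=> w nB v; have := fro_of_dilation v t0 (hB w nB).
by rewrite -!mulmxA.
Qed.

End GoodEvents.

Theorem corollary3p12 (R : realType) (disp : measure_display)
    (Omega : measurableType disp) (P : probability Omega R)
    (m r : nat) (d : 'I_m -> nat)
    (hm : (1 <= m)%N) (hr : (1 <= r)%N) (hd : forall i, (r <= d i)%N)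
    (Theta : forall i, 'M[R]_(d i, r)) (hTheta : forall i, stiefel (Theta i))
    (sigma : R) (hsigma : 0 < sigma)
    (W : 'I_(total_dim d) -> 'I_(total_dim d) -> {RV P >-> R})
    (hW : symmetric_gaussian sigma W)
    (hbound : sigma <= m%:R `^ (1 / 4) /
       (31 * Num.sqrt (r%:R * ((total_dim d)%:R / m%:R))))
    (hmd : (3 <= m)%N \/ ((2 <= m)%N /\ forall i, (6 <= d i)%N)) :
  prob_at_least P
    (1 - 1 / m%:R
       - 2 * expR (- ((3 - 2 * Num.sqrt 2) ^+ 2 / 4 * (total_dim d)%:R)))
    [set omega |
      let S := maxbet_mx Theta (random_mx W omega) in
      forall O : forall i, 'M[R]_(d i, r),
        otsm_candidate_critical S O ->
        \tr ((\mxcol_i Theta i)^T *m S *m \mxcol_i Theta i)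
          <= \tr ((\mxcol_i O i)^T *m S *m \mxcol_i O i) ->
        otsm_global_optimum S O].
Proof.
have m2 : (2 <= m)%N by case: hmd => [/ltnW|[]].
have mrD : (m * r <= total_dim d)%N.
  rewrite -{1}(card_ord m) -sum_nat_const; exact: leq_sum.
have D0 : (0 < total_dim d)%N.
  by apply: leq_trans mrD; rewrite muln_gt0 hm hr.
have mR2 : 2 <= m%:R :> R by rewrite (ler_nat _ 2).
have mR : 0 < m%:R :> R by rewrite ltr0n.
have rR : 1 <= r%:R :> R by rewrite (ler_nat _ 1).
have DR : 0 < (total_dim d)%:R :> R by rewrite ltr0n.
have rR0 : 0 < r%:R :> R by rewrite ltr0n.
have small := sigma_sqr_le mR rR0 DR hsigma hbound.
pose w := 5 * sigma * Num.sqrt (total_dim d)%:R.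
have w0 : 0 <= w by rewrite !mulr_ge0// ?sqrtr_ge0// ltW.
have [w7 w38] := noise_bounds mR2 rR (ltW DR) (ltW hsigma) small.
have [B0 [mB0 PB0 good0]] := spectral_norm_whp hsigma hW D0 w0.
have t0 : 0 <= m%:R / 2 :> R by rewrite divr_ge0// ltW.
have /choice[B hB] := fun i => block_noise_whp hTheta hsigma hW i hm hr t0.
have mB i : measurable (B i) by case: (hB i).
have [mU PU] := probability_bigsetU_le P (index_enum 'I_m) xpredT mB.
set U := \big[setU/set0]_i B i in mU PU.
exists (~` (B0 `|` U)); split.
- by apply: measurableC; exact: measurableU.
- move=> omega nBU S O cand gain.
  have nB0 : ~ B0 omega by move=> h; apply: nBU; left.
  have nB i : ~ B i omega.
    by move=> h; apply: nBU; right; rewrite /U (bigD1 i)//=; left.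
  apply: (maxbet_candidate_optimal (w := w)) cand gain => //.
  + exact: random_mx_sym hW omega.
  + exact: good0.
  + by move=> i v; have [_ _] := hB i; apply.
rewrite probability_setC; last exact: measurableU.
have P0 : (P B0 <= (2 * expR (- ((3 - 2 * Num.sqrt 2) ^+ 2 / 4
     * (total_dim d)%:R)))%:E)%E.
  by rewrite (le_trans PB0)// lee_fin ler_pM2l// global_tail.
have PU1 : (P U <= (1 / m%:R)%:E)%E.
  apply: (le_trans PU).
  apply: (@le_trans _ _ (\sum_(i < m) (1 / m%:R / m%:R : R)%:E)%E).
    apply: lee_sum => i _; have [_ + _] := hB i; move=> /le_trans; apply.
    rewrite lee_fin (block_tail (D := (total_dim d)%:R))//; first by lra.
    by rewrite -natrM ler_nat.
  rewrite sumEFin lee_fin sumr_const card_ord -[leLHS]mulr_natr divfK//.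
  by rewrite gt_eqF.
have PBU : (P (B0 `|` U) <= (2 * expR (- ((3 - 2 * Num.sqrt 2) ^+ 2 / 4
     * (total_dim d)%:R)) + 1 / m%:R)%:E)%E.
  rewrite EFinD; exact: (le_trans (measureU2 P mB0 mU) (leeD P0 PU1)).
have PE : P (B0 `|` U) = (fine (P (B0 `|` U)))%:E.
  by rewrite fineK// fin_num_measure//; exact: measurableU.
rewrite PE lee_fin in PBU.
rewrite PE -[leRHS]/((1 - fine (P (B0 `|` U)))%:E) lee_fin.
by lra.
Qed.
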